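(* Let $n\ge2$ and $\theta\in(0,\pi)$. There exists a constant $\delta_{n,\theta}>0$ (depending only on $n,\theta$) such that the following holds. Suppose that $M$ is a properly immersed two-sided capillary minimal hypersurface with contact angle $\theta$ in a relatively open set $U\subset\overline{\mathbb H^{n+1}}$. Then $$g_\theta(\Delta+|A|^2)g_\theta\ \ge\ \delta_{n,\theta}|A|^2\qquad\text{on } M\cap U\cap\{g_\theta>0\}.$$
   Context: $\mathbb H^{n+1}=\{x\in\mathbb R^{n+1}:x_1>0\}$. A capillary minimal hypersurface in $U$ with contact angle $\theta$ is a properly immersed two-sided $C^2$ hypersurface $M$ in $\overline{\mathbb H^{n+1}}$ with boundary in $\partial\mathbb H^{n+1}$ and unit normal $\nu$ such that the mean curvature vanishes on $M\cap U$ and $\langle\nu,e_1\rangle=\cos\theta$ on $\partial M\cap U$. $A$ is the second fundamental form and $\Delta$ the Laplace–Beltrami operator of $M$. With $\nu_i=\langle\nu,e_i\rangle$ and $k\in(0,1]$, define on $M$ $$g_{\theta,k}=\sqrt{1-\nu_1^2-\nu_{n+1}^2+k(\cos\theta-\nu_1)^2},$$ and the capillary tilt function $g_\theta=g_{\theta,1}$ if $n=2$, $g_\theta=g_{\theta,\frac1{n-2}}$ if $n\ge3$. *)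

(* Defs.v *)
From HB Require Import structures.
From mathcomp Require Import all_boot all_order all_algebra.
From mathcomp Require Import all_classical all_reals all_analysis.

Set Implicit Arguments.
Unset Strict Implicit.
Unset Printing Implicit Defensive.

Import Order.TTheory GRing.Theory Num.Theory.
Import numFieldNormedType.Exports.
Local Open Scope classical_set_scope.
Local Open Scope ring_scope.

Definition dotv (R : realType) (m : nat) (u v : 'rV[R]_m) : R :=
  \sum_(j < m) u ord0 j * v ord0 j.

Definition partial (R : realType) (n : nat) (i : 'I_n) (f : 'rV[R]_n -> R)
    (x : 'rV[R]_n) : R :=
  'D_(delta_mx ord0 i) f x.

Fixpoint Ck (R : realType) (n k : nat) (V : set 'rV[R]_n) (f : 'rV[R]_n -> R)
    : Prop :=
  (forall x, V x -> {for x, continuous f}) /\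
  match k with
  | 0 => True
  | k'.+1 => forall i : 'I_n,
      (forall x, V x -> derivable f x (delta_mx ord0 i)) /\
      Ck k' V (partial i f)
  end.

(* Stated for all [i] of value 0 so that [n] need not be a successor; for
   [0 < n] there is exactly one such [i]. *)
Definition model_half_space (R : realType) (n : nat) : set 'rV[R]_n :=
  [set x | forall i : 'I_n, i = 0%N :> nat -> 0 <= x ord0 i].

Definition model_boundary (R : realType) (n : nat) : set 'rV[R]_n :=
  [set x | forall i : 'I_n, i = 0%N :> nat -> x ord0 i = 0].

Definition closed_half_space (R : realType) (n : nat) : set 'rV[R]_n.+1 :=
  [set y | 0 <= y ord0 ord0].

Definition wall (R : realType) (n : nat) : set 'rV[R]_n.+1 :=
  [set y | y ord0 ord0 = 0].

Definition relatively_open (R : realType) (n : nat) (U : set 'rV[R]_n.+1) :=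
  exists2 O : set 'rV[R]_n.+1, open O & U = O `&` @closed_half_space R n.

Section ParametricGeometry.
Variables (R : realType) (n : nat).
Implicit Types (Phi : 'rV[R]_n -> 'rV[R]_n.+1) (x : 'rV[R]_n).

Definition tangent Phi (i : 'I_n) x : 'rV[R]_n.+1 :=
  \row_l partial i (fun y => Phi y ord0 l) x.

Definition jacobian Phi x : 'M[R]_(n, n.+1) :=
  \matrix_(i, l) tangent Phi i x ord0 l.

Definition first_form Phi x : 'M[R]_n :=
  \matrix_(i, j) dotv (tangent Phi i x) (tangent Phi j x).

Definition second_form Phi (N : 'rV[R]_n.+1) x : 'M[R]_n :=
  \matrix_(i, j)
    dotv (\row_l partial i (partial j (fun y => Phi y ord0 l)) x) N.

Definition shape Phi N x : 'M[R]_n :=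
  invmx (first_form Phi x) *m second_form Phi N x.

Definition mean_curvature Phi N x : R := \tr (shape Phi N x).

(* |A|^2 = g^{ik} g^{jl} h_ij h_kl, the trace of the squared shape operator *)
Definition sqnorm_A Phi N x : R := \tr (shape Phi N x *m shape Phi N x).

(* (det g)^(-1/2) d_i ((det g)^(1/2) g^{ij} d_j f) *)
Definition laplace_beltrami Phi (f : 'rV[R]_n -> R) x : R :=
  (Num.sqrt (\det (first_form Phi x)))^-1 *
  \sum_(i < n) partial i (fun y => Num.sqrt (\det (first_form Phi y)) *
    \sum_(j < n) invmx (first_form Phi y) i j * partial j f y) x.

End ParametricGeometry.

(* A local parametrization of the hypersurface F : M -> R^(n+1) by the
   relatively open subset [lp_dom] of the model half-space.  As usual up to the
   boundary, being C^2 means having a C^2 extension [lp_ext] to an open set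
   [lp_open] of R^n; its derivatives on the half-space do not depend on the
   extension. *)
Record local_param (R : realType) (n : nat) (M : topologicalType)
    (F : M -> 'rV[R]_n.+1) := LocalParam {
  lp_open : set 'rV[R]_n;
  lp_map : 'rV[R]_n -> M;
  lp_ext : 'rV[R]_n -> 'rV[R]_n.+1;
  lp_dom := lp_open `&` @model_half_space R n;
  lp_open_open : open lp_open;
  lp_continuous : {within lp_dom, continuous lp_map};
  lp_injective : forall x y, lp_dom x -> lp_dom y ->
    lp_map x = lp_map y -> x = y;
  lp_open_map : forall W : set 'rV[R]_n, open W ->
    open (lp_map @` (W `&` lp_dom));
  lp_extE : forall x, lp_dom x -> F (lp_map x) = lp_ext x;
  lp_C2 : forall l : 'I_n.+1, Ck 2 lp_open (fun y => lp_ext y ord0 l);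
  lp_immersion : forall x, lp_open x -> row_free (jacobian lp_ext x)
}.

Section Hypersurface.
Variables (R : realType) (n : nat) (M : topologicalType).
Variables (F : M -> 'rV[R]_n.+1) (nu : M -> 'rV[R]_n.+1).

(* No compatibility of parametrizations is required: since F is a C^2 immersion
   in each of them, the transition maps are automatically C^2. *)
Definition immersed_C2_hypersurface : Prop :=
  [/\ hausdorff_space M, @second_countable M &
    forall p : M, exists (X : local_param F) (x : 'rV[R]_n),
      lp_dom X x /\ lp_map X x = p].

Definition manifold_boundary : set M :=
  [set p | exists (X : local_param F) (x : 'rV[R]_n),
    [/\ lp_dom X x, @model_boundary R n x & lp_map X x = p]].

Definition unit_normal : Prop :=
  [/\ continuous nu, forall p, dotv (nu p) (nu p) = 1 &
    forall (X : local_param F) (x : 'rV[R]_n) (i : 'I_n), lp_dom X x ->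
      dotv (tangent (lp_ext X) i x) (nu (lp_map X x)) = 0].

Definition proper_in_closed_half_space : Prop :=
  (forall p, @closed_half_space R n (F p)) /\
  (forall K : set 'rV[R]_n.+1, K `<=` @closed_half_space R n -> compact K ->
    compact (F @^-1` K)).

Definition mean_curvature_at (X : local_param F) (x : 'rV[R]_n) : R :=
  mean_curvature (lp_ext X) (nu (lp_map X x)) x.

Definition sqnorm_A_at (X : local_param F) (x : 'rV[R]_n) : R :=
  sqnorm_A (lp_ext X) (nu (lp_map X x)) x.

(* [is_laplacian X f x L]: f is of class C^2 near the point [lp_map X x] (up to
   the boundary) and L is the value of its Laplacian at that point. *)
Definition is_laplacian (X : local_param F) (f : M -> R) (x : 'rV[R]_n)
    (L : R) : Prop :=
  exists (W : set 'rV[R]_n) (fe : 'rV[R]_n -> R),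
    [/\ open W, W x, Ck 2 W fe,
        forall y, (W `&` lp_dom X) y -> fe y = f (lp_map X y) &
        L = laplace_beltrami (lp_ext X) fe x].

Record capillary_minimal (theta : R) (U : set 'rV[R]_n.+1) : Prop :=
  CapillaryMinimal {
  cm_immersed : immersed_C2_hypersurface;
  cm_proper : proper_in_closed_half_space;
  cm_boundary : forall p, manifold_boundary p -> @wall R n (F p);
  cm_normal : unit_normal;
  cm_minimal : forall (X : local_param F) (x : 'rV[R]_n), lp_dom X x ->
    U (F (lp_map X x)) -> mean_curvature_at X x = 0;
  cm_angle : forall p, manifold_boundary p -> U (F p) ->
    nu p ord0 ord0 = cos theta
}.

End Hypersurface.

Definition g_fun (R : realType) (n : nat) (theta k : R) (N : 'rV[R]_n.+1) : R :=
  Num.sqrt (1 - N ord0 ord0 ^+ 2 - N ord0 ord_max ^+ 2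
            + k * (cos theta - N ord0 ord0) ^+ 2).

Definition capillary_tilt (R : realType) (n : nat) (theta : R)
    (N : 'rV[R]_n.+1) : R :=
  g_fun theta (if n == 2%N then 1 else (n - 2)%:R^-1) N.

(* Main.v *)
(* The normal nu of a C^2 hypersurface is only of class C^1, so the Jacobi equation
   Delta nu_e = - |A|^2 nu_e is used in a weak form: the field sqrt(g) grad nu_e is a
   combination of skew terms C^{ij} d_j nu_l, whose divergence makes sense through
   difference quotients.  This weak divergence is unique, obeys a product rule and
   agrees with the classical one, so for f^2 = 1 - a^2 - b^2 + k (c - a)^2, where
   a = nu_1, b = nu_(n+1), c = cos theta, the field sqrt(g) f grad f yields
     f (Delta + |A|^2) f = (1 + k c (c - a)) |A|^2 - (1 - k) |A e_1|^2
       - |A e_(n+1)|^2 - |A (m e_1 + b e_(n+1))|^2 / f^2,  m = (1 - k) a + k c,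
   at interior points.  The subtracted quadratic form is diagonal in an orthonormal
   tangential pair (u_1, u_2) and at most |A u_1|^2 + (1 - k + k c^2) |A u_2|^2.  The
   remaining diagonal block of the trace-free A has trace -(x + y), with x, y the
   diagonal entries of A on u_1, u_2, and size n - 2, hence square norm at least
   k (x + y)^2; the claim becomes the positivity of a binary quadratic form in (x, y).
   Boundary points are limits of interior ones. *)
Require Import Defs.
From HB Require Import structures.
From mathcomp Require Import all_boot all_order all_algebra.
From mathcomp Require Import all_classical all_reals all_analysis.
From mathcomp Require Import perm ring lra.
Set Implicit Arguments.
Unset Strict Implicit.
Unset Printing Implicit Defensive.
Import Order.TTheory GRing.Theory Num.Theory.
Import numFieldNormedType.Exports.
Local Open Scope classical_set_scope.
Local Open Scope ring_scope.

(** The usual route to the Jacobi equation passes through Codazzi's equation, which differentiates a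
    second fundamental form that is here only continuous. The substitute rests on two facts. The
    skew coefficients are, up to a factor sqrt(g), the 2x2 minors of the dual frame, so they involve
    only first derivatives of the parametrization and are C^1. Their contraction with the
    derivatives of nu gives the gradient of a component of nu exactly because the shape operator is
    trace-free. The value k = 1/(n - 2) is the Cauchy-Schwarz constant of a block of size n - 2; for
    n = 2 this block is empty, x + y = 0, and k = 1 is harmless. With e = |cos theta|, the
    determinant of the binary form at the least favourable value of nu_1 is k^2 (1 - e)^3 (1 - k e),
    positive because e < 1. A sixth of it can be given away as delta. Minimality is known on the
    half-space only, not for the extension of a parametrization beyond it; this is why the
    identities are first proved at interior points. *)

(** * Joint difference quotients and C^1 functions *)

Section StrictDifferentiability.
Variables (R : realType) (n : nat).
Implicit Types (i j : 'I_n) (f u v : 'rV[R]_n -> R) (p x : 'rV[R]_n).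
Implicit Types (T S : R -> 'rV[R]_n -> R).

Definition shift_dir i (h : R) x : 'rV[R]_n := h *: delta_mx ord0 i + x.

Definition dquot i f (h : R) x : R := h^-1 * (f (shift_dir i h x) - f x).

Definition jfilter p : set_system (R * 'rV[R]_n) :=
  filter_prod (dnbhs (0 : R)) (nbhs p).

#[local] Instance jfilter_proper p : ProperFilter (jfilter p).
Proof. exact: filter_prod_proper. Qed.

Lemma cvg_jfst p : fst @ jfilter p --> (dnbhs (0 : R)).
Proof. exact: cvg_fst. Qed.

Lemma cvg_jsnd p : snd @ jfilter p --> p.
Proof. exact: cvg_snd. Qed.

Lemma cvg_jpair (U : Type) (G : set_system U) (FG : Filter G) (a : U -> R)
    (b : U -> 'rV[R]_n) p :
  a @ G --> dnbhs (0 : R) -> b @ G --> p -> (fun z => (a z, b z)) @ G --> jfilter p.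
Proof. by move=> ha hb; exact: (cvg_pair ha hb). Qed.

Definition jcvg T p (l : R) :=
  (fun z : R * 'rV[R]_n => T z.1 z.2) @ jfilter p --> l.

(* Difference quotients converge jointly in the increment and the base point;
   along an open set this is equivalent to being of class C^1. *)
Definition strict f p (d : 'I_n -> R) :=
  {for p, continuous f} /\ forall i, jcvg (dquot i f) p (d i).

Lemma jcvg_unique T p l l' : jcvg T p l -> jcvg T p l' -> l = l'.
Proof. by move=> h h'; apply: cvg_unique h h'; exact: norm_hausdorff. Qed.

Lemma jcvg_near T S p l :
  (\forall z \near jfilter p, T z.1 z.2 = S z.1 z.2) ->
  jcvg T p l -> jcvg S p l.
Proof. by move=> e; apply: cvg_trans; exact: near_eq_cvg. Qed.

Lemma jcvg_ext T S p l : (forall h x, T h x = S h x) -> jcvg T p l -> jcvg S p l.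
Proof. by move=> e; apply: jcvg_near; near=> z; exact: e. Unshelve. all: by end_near. Qed.

Lemma jcvgD T S p l m :
  jcvg T p l -> jcvg S p m -> jcvg (fun h x => T h x + S h x) p (l + m).
Proof. exact: cvgD. Qed.

Lemma jcvgM T S p l m :
  jcvg T p l -> jcvg S p m -> jcvg (fun h x => T h x * S h x) p (l * m).
Proof. exact: cvgM. Qed.

Lemma jcvgN T p l : jcvg T p l -> jcvg (fun h x => - T h x) p (- l).
Proof. exact: cvgN. Qed.

Lemma jcvgV T p l : l != 0 -> jcvg T p l -> jcvg (fun h x => (T h x)^-1) p l^-1.
Proof. by move=> l0; exact: (cvgV l0). Qed.

Lemma jcvg_cst p (c : R) : jcvg (fun _ _ => c) p c.
Proof. exact: cvg_cst. Qed.

Lemma jcvg_sum (I : Type) (r : seq I) (T : I -> R -> 'rV[R]_n -> R) (l : I -> R) p :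
  (forall k, jcvg (T k) p (l k)) ->
  jcvg (fun h x => \sum_(k <- r) T k h x) p (\sum_(k <- r) l k).
Proof.
move=> H; elim: r => [|k r IH].
  by rewrite big_nil; apply: jcvg_ext _ (@jcvg_cst p 0) => h x; rewrite big_nil.
rewrite big_cons; apply: jcvg_ext _ (jcvgD (H k) IH) => h x; by rewrite big_cons.
Qed.

Lemma jcvg_cont f p : {for p, continuous f} -> jcvg (fun _ => f) p (f p).
Proof.
by move=> cf; apply: (@cvg_comp _ _ _ snd f _ (nbhs p)) => //; exact: cvg_jsnd.
Qed.

Lemma cvg_shift_dir i p :
  (fun z : R * 'rV[R]_n => shift_dir i z.1 z.2) @ jfilter p --> p.
Proof.
have h1 : fst @ jfilter p --> (0 : R).
  by apply: cvg_trans (@cvg_jfst p) _; exact: nbhs_dnbhs.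
have h2 := @cvgZr_tmp _ _ _ _ _ _ _ (delta_mx ord0 i : 'rV[R]_n) h1.
have := cvgD (h2 _) (@cvg_jsnd p).
by rewrite scale0r add0r => H; exact: H.
Qed.

Lemma jcvg_shift T i p l : jcvg T p l -> jcvg (fun h x => T h (shift_dir i h x)) p l.
Proof.
move=> H; apply: (@cvg_comp _ _ _ (fun z => (z.1, shift_dir i z.1 z.2)) (fun z => T z.1 z.2) _ _ _ _ H).
apply: cvg_jpair; first exact: cvg_jfst.
exact: cvg_shift_dir.
Qed.

Lemma near_shift_dir i (P : set 'rV[R]_n) p :
  (\forall x \near p, P x) ->
  \forall z \near jfilter p, P (shift_dir i z.1 z.2) /\ P z.2.
Proof.
move=> HP; near=> z; split; near: z.
  exact: (@cvg_shift_dir i p _ HP).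
exact: (@cvg_jsnd p _ HP).
Unshelve. all: by end_near. Qed.

Lemma near_increment p : \forall z \near jfilter p, z.1 != 0 :> R.
Proof. exact: (@cvg_jfst p _ (nbhs_dnbhs_neq (0 : R))). Qed.

Lemma strict_unique f p d d' : strict f p d -> strict f p d' -> d =1 d'.
Proof. by move=> [_ h] [_ h'] i; exact: jcvg_unique (h i) (h' i). Qed.

Lemma strict_eq f p d d' : (forall i, d i = d' i) -> strict f p d -> strict f p d'.
Proof. by move=> e [c h]; split => // i; rewrite -e. Qed.

Lemma strict_near f v p d :
  (\forall x \near p, f x = v x) -> strict f p d -> strict v p d.
Proof.
move=> e [cf df]; split=> [|i].
  change (v @ p --> v p); rewrite -(nbhs_singleton e).
  by apply: (cvg_trans (near_eq_cvg e)); exact: cf.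
apply: jcvg_near _ (df i); near=> z.
have [e1 e2] : f (shift_dir i z.1 z.2) = v (shift_dir i z.1 z.2) /\ f z.2 = v z.2.
  by near: z; exact: (near_shift_dir i e).
by rewrite /dquot e1 e2.
Unshelve. all: by end_near. Qed.

Lemma strict_ext f v p d : (forall x, f x = v x) -> strict f p d -> strict v p d.
Proof. by move=> e; apply: strict_near; near=> x; exact: e. Unshelve. all: by end_near. Qed.

Lemma strict_cst p (c : R) : strict (fun _ => c) p (fun _ => 0).
Proof.
split=> [|i]; first exact: cst_continuous.
by apply: jcvg_ext _ (@jcvg_cst p 0) => h x; rewrite /dquot subrr mulr0.
Qed.

Lemma strictD f v p d e :
  strict f p d -> strict v p e -> strict (fun x => f x + v x) p (fun i => d i + e i).
Proof.
move=> [cf df] [cv dv]; split=> [|i]; first exact: continuousD cf cv.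
apply: jcvg_ext _ (jcvgD (df i) (dv i)) => h x.
by rewrite /dquot -mulrDr opprD addrACA.
Qed.

Lemma strictN f p d : strict f p d -> strict (fun x => - f x) p (fun i => - d i).
Proof.
move=> [cf df]; split=> [|i]; first exact: continuousN cf.
by apply: jcvg_ext _ (jcvgN (df i)) => h x; rewrite /dquot -mulrN opprD.
Qed.

Lemma strictM f v p d e : strict f p d -> strict v p e ->
  strict (fun x => f x * v x) p (fun i => d i * v p + f p * e i).
Proof.
move=> [cf df] [cv dv]; split=> [|i]; first exact: continuousM cf cv.
have cvs : jcvg (fun h x => v (shift_dir i h x)) p (v p) := jcvg_shift i (jcvg_cont cv).
apply: jcvg_ext _ (jcvgD (jcvgM (df i) cvs) (jcvgM (jcvg_cont cf) (dv i))) => h x.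
rewrite /dquot; ring.
Qed.

Lemma strict_sum (I : Type) (r : seq I) (f : I -> 'rV[R]_n -> R) p (d : I -> 'I_n -> R) :
  (forall k, strict (f k) p (d k)) ->
  strict (fun x => \sum_(k <- r) f k x) p (fun i => \sum_(k <- r) d k i).
Proof.
move=> H; elim: r => [|k r IH].
  apply: strict_eq _ (strict_ext _ (@strict_cst p 0)) => i; first by rewrite big_nil.
  by rewrite big_nil.
apply: strict_eq _ (strict_ext _ (strictD (H k) IH)) => i; first by rewrite big_cons.
by rewrite big_cons.
Qed.

Lemma strictV f p d : f p != 0 -> strict f p d ->
  strict (fun x => (f x)^-1) p (fun i => - d i / f p ^+ 2).
Proof.
move=> fp0 [cf df]; split=> [|i]; first exact: continuousV fp0 cf.
have cfs : jcvg (fun h x => f (shift_dir i h x)) p (f p) := jcvg_shift i (jcvg_cont cf).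
have cV : jcvg (fun h x => (f (shift_dir i h x) * f x)^-1) p (f p ^+ 2)^-1.
  exact: (jcvgV (expf_neq0 2 fp0) (jcvgM cfs (jcvg_cont cf))).
apply: jcvg_near _ (jcvgM (jcvgN (df i)) cV); near=> z.
have [f1 f2] : f (shift_dir i z.1 z.2) != 0 /\ f z.2 != 0.
  near: z; apply: (near_shift_dir i (P := fun x => f x != 0)).
  exact: cvgr_neq0 cf fp0.
have z0 : z.1 != 0 by near: z; exact: near_increment.
by rewrite /dquot; field; rewrite f1 f2.
Unshelve. all: by end_near. Qed.

Lemma strict_sqrt f p d : 0 < f p -> strict f p d ->
  strict (fun x => Num.sqrt (f x)) p (fun i => d i / (2 * Num.sqrt (f p))).
Proof.
move=> fp0 [cf df].
have cs : {for p, continuous (fun x => Num.sqrt (f x))}.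
  exact: (continuous_comp cf (@sqrt_continuous R (f p))).
split=> // i.
have cfs : jcvg (fun h x => Num.sqrt (f (shift_dir i h x))) p (Num.sqrt (f p))
  := jcvg_shift i (jcvg_cont cs).
have sp0 : 0 < Num.sqrt (f p) by rewrite sqrtr_gt0.
have cV : jcvg (fun h x => (Num.sqrt (f (shift_dir i h x)) + Num.sqrt (f x))^-1) p
    (2 * Num.sqrt (f p))^-1.
  have s0 : Num.sqrt (f p) + Num.sqrt (f p) != 0 by rewrite gt_eqF// addr_gt0.
  rewrite mulr_natl mulr2n.
  exact: (jcvgV s0 (jcvgD cfs (jcvg_cont cs))).
apply: jcvg_near _ (jcvgM (df i) cV); near=> z.
have [f1 f2] : 0 < f (shift_dir i z.1 z.2) /\ 0 < f z.2.
  near: z; apply: (near_shift_dir i (P := fun x => 0 < f x)).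
  exact: cvgr_gt cf _ fp0.
have z0 : z.1 != 0 by near: z; exact: near_increment.
rewrite /dquot -mulrA; congr (_ * _).
rewrite -{1}[f (shift_dir _ _ _)]sqr_sqrtr ?ltW// -{1}[f z.2]sqr_sqrtr ?ltW//.
rewrite subr_sqr mulfK// gt_eqF// addr_gt0 ?sqrtr_gt0//.
Unshelve. all: by end_near. Qed.

Lemma jcvg_dnbhs0 T p l : jcvg T p l -> T h p @[h --> dnbhs (0 : R)] --> l.
Proof.
move=> H; apply: (@cvg_comp _ _ _ (fun h : R => (h, p)) (fun z => T z.1 z.2) _ _ _ _ H).
by apply: cvg_jpair; [exact: cvg_id|exact: cvg_cst].
Qed.

Lemma strict_derivable f p d i : strict f p d ->
  derivable f p (delta_mx ord0 i) /\ partial i f p = d i.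
Proof.
move=> [_ /(_ i) /jcvg_dnbhs0 df].
by split; [apply: cvgP df|apply: cvg_lim df; exact: norm_hausdorff].
Qed.

(** Joint convergence bounds the distance from [d i p] to the quotients at all base points [x] near
    [p] at once; letting [h] tend to 0 at a fixed [x] turns the quotient into [d i x]. *)
Lemma strict_continuous f p (d : 'I_n -> 'rV[R]_n -> R) i :
  (\forall x \near p, strict f x (d^~ x)) -> {for p, continuous (d i)}.
Proof.
move=> H; apply/(@cvgrPdist_le _ _ _ _ (nbhs_filter p)) => e e0.
have [_ /(_ i) dp] := nbhs_singleton H.
move/cvgrPdist_le : dp => /(_ _ e0) [[A B] /= [HA HB] AB].
near=> x.
have Bx : B x by near: x.
have [_ /(_ i) /jcvg_dnbhs0 dx] : strict f x (d^~ x) by near: x.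
have dn : `|d i p - dquot i f h x| @[h --> dnbhs (0 : R)] --> `|d i p - d i x|.
  by apply: cvg_norm; apply: cvgB dx; exact: cvg_cst.
apply: ler_cvg_to dn (cvg_cst e) _; near=> h.
by apply: (AB (h, x)); split => //=; near: h.
Unshelve. all: by end_near. Qed.

End StrictDifferentiability.

Section ContinuouslyDifferentiable.
Variables (R : realType) (n : nat).
Implicit Types (i j : 'I_n) (f u v : 'rV[R]_n -> R) (p x : 'rV[R]_n).

(** The mean value theorem at a moving base point needs the property on the whole segment swept by
    the increment. *)
Lemma near_segment i (P : set 'rV[R]_n) p : (\forall x \near p, P x) ->
  \forall z \near jfilter p, forall t, `|t| <= `|z.1| -> P (shift_dir i t z.2).
Proof.
move=> HP.
have h1 : (fun z : R * 'rV[R]_n => z.1) @ filter_prod (nbhs (0 : R)) (nbhs p) --> (0 : R).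
  exact: cvg_fst.
have h1' := @cvgZr_tmp _ _ _ _ _ _ _ (delta_mx ord0 i : 'rV[R]_n) h1.
have h2 : (fun z : R * 'rV[R]_n => z.2) @ filter_prod (nbhs (0 : R)) (nbhs p) --> p.
  exact: cvg_snd.
have := cvgD (h1' _) h2; rewrite scale0r add0r => /(_ _ _) H.
have [[A B] /= [/nbhs_ballP[r /= r0 Ar] HB] AB] := H _ HP.
near=> z => t tz.
apply: (AB (t, z.2)); split => /=; last by near: z; exact: (@cvg_jsnd _ _ p _ HB).
apply: Ar; rewrite /ball /= sub0r normrN (le_lt_trans tz)//.
rewrite -[z.1]opprK normrN -sub0r; near: z.
have b0 : nbhs (0 : R) (ball (0 : R) r) by exact: nbhsx_ballx.
exact: (@cvg_jfst _ _ p _ (nbhs_dnbhs b0)).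
Unshelve. all: by end_near. Qed.

Lemma shift_dirD i (s t : R) x : shift_dir i (s + t) x = shift_dir i s (shift_dir i t x).
Proof. by rewrite /shift_dir scalerDl addrA. Qed.

Lemma shift_dir0 i x : shift_dir i 0 x = x.
Proof. by rewrite /shift_dir scale0r add0r. Qed.

Lemma is_derive_line i f x (t : R) :
  derivable f (shift_dir i t x) (delta_mx ord0 i) ->
  is_derive t 1 (fun s => f (shift_dir i s x)) (partial i f (shift_dir i t x)).
Proof.
have E : (fun h : R => h^-1 *: ((f \o shift (shift_dir i t x)) (h *: delta_mx ord0 i)
      - f (shift_dir i t x))) =
   (fun h : R => h^-1 *: (((fun s => f (shift_dir i s x)) \o shift t) (h *: (1 : R))
      - f (shift_dir i t x))).
  apply/funext => h; congr (_ *: (f _ - _)).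
  by rewrite /= -[h *: 1]/(h * 1) mulr1 shift_dirD.
move=> df; split; first by rewrite /derivable -E.
by rewrite /partial /derive E.
Qed.

Lemma mean_value_dir i f x (h : R) : h != 0 ->
  (forall t, `|t| <= `|h| -> derivable f (shift_dir i t x) (delta_mx ord0 i)) ->
  exists2 c, `|c| <= `|h| & dquot i f h x = partial i f (shift_dir i c x).
Proof.
move=> h0 H.
have cont a b : (forall t, a <= t <= b -> `|t| <= `|h|) ->
    {within `[a, b], continuous (fun s => f (shift_dir i s x))}.
  move=> K; apply: derivable_within_continuous => t; rewrite in_itv/= => /K/H df.
  by have [] := is_derive_line df.
rewrite /dquot; have [hp|hn] := ltP 0 h.
  have K t : 0 <= t <= h -> `|t| <= `|h|.
    by case/andP => t0 th; rewrite !ger0_norm// (le_trans t0).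
  have [|c] := MVT hp _ (cont _ _ K) (df := fun s => partial i f (shift_dir i s x)).
    move=> t; rewrite in_itv/= => /andP[t0 th].
    by apply: is_derive_line; apply/H/K; rewrite !ltW.
  rewrite in_itv/= => /andP[c0 ch]; rewrite shift_dir0 subr0 => ->.
  by exists c; [apply: K; rewrite !ltW|rewrite mulrC mulfK].
have {}hn : h < 0 by rewrite lt_neqAle h0.
have K t : h <= t <= 0 -> `|t| <= `|h|.
  by case/andP => th t0; rewrite !ler0_norm ?lerN2// ltW.
have [|c] := MVT hn _ (cont _ _ K) (df := fun s => partial i f (shift_dir i s x)).
  move=> t; rewrite in_itv/= => /andP[t0 th].
  by apply: is_derive_line; apply/H/K; rewrite !ltW.
rewrite in_itv/= => /andP[c0 ch]; rewrite shift_dir0 sub0r => E.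
exists c; first by apply: K; rewrite !ltW.
by rewrite -opprB E !mulrN opprK mulrC mulfK.
Qed.

(** Each joint quotient is a value of [partial i f] on a short segment near [p], so continuity of
    the partial derivative suffices. *)
Lemma Ck1_strict (V : set 'rV[R]_n) f p : open V -> V p -> Ck 1 V f ->
  strict f p (fun i => partial i f p).
Proof.
move=> oV Vp [cf df]; split=> [|i]; first exact: cf.
have nV : \forall x \near p, V x by exact: open_nbhs_nbhs.
have [di [cdi _]] := df i.
apply/(@cvgrPdist_le _ _ _ _ (@filter_filter _ _ (jfilter_proper p))) => e e0.
have nd : \forall x \near p, `|partial i f p - partial i f x| <= e.
  by move/(@cvgrPdist_le _ _ _ _ (nbhs_filter p)) : (cdi _ Vp); exact.
near=> z.
have z0 : z.1 != 0 by near: z; exact: near_increment.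
have Vs : forall t, `|t| <= `|z.1| -> V (shift_dir i t z.2).
  by near: z; exact: near_segment.
have ds : forall t, `|t| <= `|z.1| ->
    `|partial i f p - partial i f (shift_dir i t z.2)| <= e.
  by near: z; exact: (near_segment i nd).
have [t /Vs/di//|c ch ->] := mean_value_dir z0 (f := f) (i := i) (x := z.2).
exact: ds.
Unshelve. all: by end_near. Qed.

Lemma Ck2_strict (V : set 'rV[R]_n) f p : open V -> V p -> Ck 2 V f ->
  strict f p (fun i => partial i f p) /\
  forall j, strict (partial j f) p (fun i => partial i (partial j f) p).
Proof.
move=> oV Vp [cf df]; split=> [|j]; last by have [_ /(Ck1_strict oV Vp)] := df j.
apply: (Ck1_strict oV Vp); split => // i; have [di [cdi _]] := df i.
by split.
Qed.

End ContinuouslyDifferentiable.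

(** * Weak divergence of continuous fields *)

Section WeakDivergence.
Variables (R : realType) (n : nat).
Implicit Types (i j : 'I_n) (f : 'rV[R]_n -> R) (p x y : 'rV[R]_n).
Implicit Types (V : set 'rV[R]_n) (X Y : 'I_n -> 'rV[R]_n -> R).

(* The continuous field X is approximated on V by fields T_h whose difference
   divergence converges at p; X itself need not be differentiable. *)
Definition wdiv V X (rho : R) p :=
  exists T : 'I_n -> R -> 'rV[R]_n -> R,
    (forall i x, V x -> jcvg (T i) x (X i x)) /\
    jcvg (fun h x => \sum_i dquot i (T i h) h x) p rho.

Lemma wdiv_strict V X (d : 'I_n -> 'I_n -> R) p :
  (forall i x, V x -> {for x, continuous (X i)}) ->
  (forall i, strict (X i) p (d i)) -> wdiv V X (\sum_i d i i) p.
Proof.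
move=> cX dX; exists (fun i _ x => X i x); split.
  by move=> i x Vx; apply: jcvg_cont; exact: cX.
by apply: (jcvg_sum (T := fun i h x => dquot i (X i) h x)) => i; exact: (dX i).2.
Qed.

Lemma wdiv_ext V X Y rho rho' p : (forall i x, V x -> X i x = Y i x) ->
  rho = rho' -> wdiv V X rho p -> wdiv V Y rho' p.
Proof.
move=> e <- [T [T1 T2]]; exists T; split=> // i x Vx.
by rewrite -e//; exact: T1.
Qed.

Lemma wdiv_sum (I : Type) (r : seq I) V (X : I -> 'I_n -> 'rV[R]_n -> R)
    (rho : I -> R) p : (forall k, wdiv V (X k) (rho k) p) ->
  wdiv V (fun i x => \sum_(k <- r) X k i x) (\sum_(k <- r) rho k) p.
Proof.
move=> H; have /choice[T HT] := H.
exists (fun i h x => \sum_(k <- r) T k i h x); split.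
  move=> i x Vx; apply: (jcvg_sum (T := fun k h x => T k i h x)) => k.
  exact: (HT k).1.
have K := jcvg_sum (r := r) (fun k => (HT k).2).
apply: jcvg_ext _ K => h x.
rewrite exchange_big /=; apply: eq_bigr => i _.
by rewrite /dquot -mulr_sumr sumrB.
Qed.

(** The discrete product rule is exact: it leaves the approximants at the shifted point, where they
    have the same limit. *)
Lemma wdivM V X f (df : 'I_n -> R) rho p : V p ->
  (forall x, V x -> {for x, continuous f}) -> strict f p df -> wdiv V X rho p ->
  wdiv V (fun i x => f x * X i x) (f p * rho + \sum_i df i * X i p) p.
Proof.
move=> Vp cf [_ sf] [T [T1 T2]].
exists (fun i h x => f x * T i h x); split.
  by move=> i x Vx; exact: jcvgM (jcvg_cont (cf _ Vx)) (T1 i x Vx).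
have T3 i : jcvg (fun h x => T i h (shift_dir i h x)) p (X i p).
  exact: jcvg_shift (T1 i p Vp).
have T4 := jcvg_sum (r := index_enum 'I_n) (fun i => jcvgM (sf i) (T3 i)).
apply: jcvg_ext _ (jcvgD (jcvgM (jcvg_cont (cf _ Vp)) T2) T4) => h x.
rewrite mulr_sumr -big_split; apply: eq_bigr => i _; rewrite /dquot /=; ring.
Qed.

Lemma wdivB V X Y rho rho' p :
  wdiv V X rho p -> wdiv V Y rho' p -> wdiv V (fun i x => X i x - Y i x) (rho - rho') p.
Proof.
move=> [T [T1 T2]] [S [S1 S2]]; exists (fun i h x => T i h x - S i h x); split.
  by move=> i x Vx; exact: jcvgD (T1 i x Vx) (jcvgN (S1 i x Vx)).
apply: jcvg_ext _ (jcvgD T2 (jcvgN S2)) => h x.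
rewrite -sumrB; apply: eq_bigr => i _; rewrite /dquot; ring.
Qed.

Lemma shift_dirC i j (s t : R) x :
  shift_dir i s (shift_dir j t x) = shift_dir j t (shift_dir i s x).
Proof. by rewrite /shift_dir addrCA. Qed.

(* Mixed second differences commute exactly, so they cancel against a skew
   coefficient although f is only assumed to be of class C^1. *)
Lemma wdiv_skew V (C : 'I_n -> 'I_n -> 'rV[R]_n -> R) (dC : 'I_n -> 'I_n -> 'I_n -> R)
    f (df : 'I_n -> 'rV[R]_n -> R) p : V p ->
  (forall i j x, C j i x = - C i j x) ->
  (forall i j x, V x -> {for x, continuous (C i j)}) ->
  (forall i j, strict (C i j) p (dC i j)) ->
  (forall x, V x -> strict f x (df^~ x)) ->
  wdiv V (fun i x => \sum_j C i j x * df j x) (\sum_i \sum_j dC i j i * df j p) p.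
Proof.
move=> Vp aC cC sC sf.
exists (fun i h x => \sum_j C i j x * dquot j f h x); split.
  move=> i x Vx; apply: (jcvg_sum (T := fun j h x => C i j x * dquot j f h x)) => j.
  by apply: jcvgM; [apply: jcvg_cont; exact: cC|exact: (sf x Vx).2].
have H i j : jcvg (fun h x => dquot i (C i j) h x * dquot j f h (shift_dir i h x)) p
    (dC i j i * df j p).
  by apply: jcvgM; [exact: (sC i j).2|exact: jcvg_shift ((sf p Vp).2 j)].
have K := jcvg_sum (r := index_enum 'I_n) (fun i => jcvg_sum (r := index_enum 'I_n) (H i)).
apply: jcvg_ext _ K => h x.
(* [S] is what the discrete product rule leaves besides the terms in which [C] is differenced. *)
pose S := \sum_i \sum_j C i j x * dquot i (dquot j f h) h x.
have S0 : S = 0.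
  have : S = - S.
    rewrite {1}/S exchange_big /= -sumrN; apply: eq_bigr => i _.
    rewrite -sumrN; apply: eq_bigr => j _; rewrite aC mulNr; congr (- (_ * _)).
    rewrite /dquot shift_dirC; ring.
  by move/eqP; rewrite -addr_eq0 -mulr2n mulrn_eq0 /= => /eqP.
apply: etrans (esym (addr0 _)) _; rewrite -[X in _ + X]S0 /S -big_split; apply: eq_bigr => i _ /=.
rewrite -big_split /dquot -sumrB mulr_sumr; apply: eq_bigr => j _ /=; ring.
Qed.

End WeakDivergence.

(** * Grid averages and uniqueness of the weak divergence *)

Section GridAverages.
Variables (R : realType) (n : nat) (m : nat) (h : R).
Hypotheses (m0 : (0 < m)%N) (h0 : 0 < h).
Implicit Types (i j : 'I_n) (f : 'rV[R]_n -> R) (x y : 'rV[R]_n) (l : seq 'I_n).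

Let s : R := m%:R * h.

Definition avg j f x : R := m%:R^-1 * \sum_(t < m) f (shift_dir j (t%:R * h) x).

Definition avgs l f : 'rV[R]_n -> R := foldr avg f l.

Lemma norm_delta_row_le1 i : `|delta_mx ord0 i : 'rV[R]_n| <= 1.
Proof.
rewrite [leLHS]/Num.norm /= mx_normrE; apply: bigmax_le => //= k _.
by rewrite mxE; case: (_ && _); rewrite ?normr1 ?normr0.
Qed.

Lemma shift_dir_dist j (t : nat) x : (t <= m)%N -> `|shift_dir j (t%:R * h) x - x| <= s.
Proof.
move=> tm; have th0 : 0 <= t%:R * h by rewrite mulr_ge0// ltW.
rewrite /shift_dir addrK normrZ ger0_norm//.
apply: le_trans (ler_wpM2l th0 (norm_delta_row_le1 j)) _.
by rewrite mulr1 /s ler_pM2r// ler_nat.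
Qed.

Lemma avg_bound j f x (c e : R) :
  (forall t : 'I_m, `|f (shift_dir j (t%:R * h) x) - c| <= e) -> `|avg j f x - c| <= e.
Proof.
move=> H; have mR : 0 < m%:R :> R by rewrite ltr0n.
have -> : avg j f x - c = m%:R^-1 * \sum_(t < m) (f (shift_dir j (t%:R * h) x) - c).
  by rewrite sumrB sumr_const card_ord mulrBr -[c *+ m]mulr_natl mulKf ?gt_eqF.
rewrite normrM normfV (gtr0_norm mR) ler_pdivrMl//.
apply: le_trans (ler_norm_sum _ _ _) _.
apply: le_trans (ler_sum _ (fun t _ => H t)) _.
by rewrite sumr_const card_ord mulr_natl.
Qed.

Lemma avgs_bound l f x (c e : R) :
  (forall y, `|y - x| <= s * (size l)%:R -> `|f y - c| <= e) -> `|avgs l f x - c| <= e.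
Proof.
elim: l x => [|j l IH] x H /=; first by apply: H; rewrite subrr normr0 mulr0.
apply: avg_bound => t; apply: IH => y ly; apply: H.
rewrite /= -natr1 mulrDr mulr1.
have -> : y - x = (y - shift_dir j (t%:R * h) x) + (shift_dir j (t%:R * h) x - x).
  by rewrite addrA subrK.
apply: le_trans (ler_normD _ _) (lerD ly _).
by apply: shift_dir_dist; exact: ltnW.
Qed.

Lemma avg_dquot i j f : avg j (dquot i f h) = dquot i (avg j f) h.
Proof.
apply/funext => x; rewrite /avg /dquot -mulrBr -sumrB mulrCA -mulr_sumr; congr (_ * (_ * _)).
by apply: eq_bigr => t _; rewrite shift_dirC.
Qed.

Lemma avgs_dquot i l f : avgs l (dquot i f h) = dquot i (avgs l f) h.
Proof. by elim: l => //= j l ->; rewrite avg_dquot. Qed.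

(** The grid step equals the increment of the quotient, so only the two ends survive. *)
Lemma avg_dquot_telescope i f x :
  avg i (dquot i f h) x = (f (shift_dir i s x) - f x) / s.
Proof.
rewrite /avg /dquot -mulr_sumr [RHS]mulrC /s invfM -mulrA; congr (_ * (_ * _)).
pose u t := f (shift_dir i (t%:R * h) x).
have -> : f x = u 0%N by rewrite /u mul0r shift_dir0.
rewrite -/(u m) -(telescope_sumr u (leq0n m)) big_mkord.
apply: eq_bigr => t _; rewrite /u; have -> : t.+1%:R * h = h + t%:R * h.
  by rewrite -natr1 mulrDl mul1r addrC.
by rewrite shift_dirD.
Qed.

(** A discrete divergence theorem on the grid cube: averaging in direction [i] leaves two opposite
    faces and trades the factor 1/h for 1/s; the other directions merely average. *)
Lemma avgs_dquot_bound i l f x (e : R) : i \in l ->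
  (forall y, `|y - x| <= s * (size l)%:R -> `|f y| <= e) ->
  `|avgs l (dquot i f h) x| <= 2 * e / s.
Proof.
have s0 : 0 < s by rewrite mulr_gt0// ltr0n.
elim: l x => // j l IH x; rewrite in_cons => /orP[/eqP <-|il] H /=; last first.
  rewrite -[X in `|X|]subr0; apply: avg_bound => t; rewrite subr0.
  apply: IH => // y ly; apply: H; rewrite /= -natr1 mulrDr mulr1.
  have -> : y - x = (y - shift_dir j (t%:R * h) x) + (shift_dir j (t%:R * h) x - x).
    by rewrite addrA subrK.
  apply: le_trans (ler_normD _ _) (lerD ly _).
  by apply: shift_dir_dist; exact: ltnW.
have B y : `|y - x| <= s -> `|avgs l f y| <= e.
  move=> yx; rewrite -[X in `|X|]subr0; apply: avgs_bound => z zy.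
  rewrite subr0; apply: H; rewrite /= -natr1 mulrDr mulr1.
  by rewrite -[z](subrK y) -addrA (le_trans (ler_normD _ _)) ?lerD.
rewrite avgs_dquot avg_dquot_telescope normrM normfV (gtr0_norm s0).
rewrite ler_pM2r ?invr_gt0// (le_trans (ler_normB _ _))// mulrC mulr2n mulrDr mulr1.
by rewrite lerD ?B// ?shift_dir_dist// subrr normr0 ltW.
Qed.

Lemma avgs_sum l (F : 'I_n -> 'rV[R]_n -> R) x :
  avgs l (fun y => \sum_i F i y) x = \sum_i avgs l (F i) x.
Proof.
elim: l x => //= j l IH x; rewrite /avg -mulr_sumr exchange_big; congr (_ * _).
by apply: eq_bigr => t _; rewrite IH.
Qed.

End GridAverages.

Section WeakDivergenceUnique.
Variables (R : realType) (n : nat).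
Implicit Types (p x : 'rV[R]_n) (V : set 'rV[R]_n) (X : 'I_n -> 'rV[R]_n -> R).

(* Averaging over a grid cube of side s telescopes the difference divergence
   into boundary terms of size o(1) / s. *)
Lemma wdiv0_eq0 V X (rho : R) p : open V -> V p ->
  (forall i x, V x -> X i x = 0) -> wdiv V X rho p -> rho = 0.
Proof.
move=> oV Vp X0 [T [T1 T2]]; apply/eqP; apply: contraT => rho0.
(* The averaged difference divergence will be within [e] of both [rho] and 0, which is absurd for
   |rho| = 3e > 0. *)
pose e := `|rho| / 3.
have e0 : 0 < e by rewrite divr_gt0// normr_gt0.
move/(@cvgrPdist_le _ _ _ _ (@filter_filter _ _ (jfilter_proper p))) : T2 => /(_ _ e0).
move=> [[A B] /= [HA HB] AB].
have /nbhs_ballP[r' /= r'0 Br] : nbhs p (V `&` B).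
  by apply: filterI => //; exact: open_nbhs_nbhs.
pose r := r' / 2.
have r0 : 0 < r by rewrite divr_gt0.
pose K := [set x : 'rV[R]_n | `|p - x| <= r].
have KVB x : K x -> V x /\ B x.
  move=> Kx; apply: Br; rewrite -ball_normE /ball_ /= (le_lt_trans Kx)//.
  by rewrite /r ltr_pdivrMr// ltr_pMr// ltr1n.
have KE : K = closed_ball p r by rewrite closed_ballE.
have cK : compact K.
  apply: bounded_closed_compact; last by rewrite KE; exact: closed_ball_closed.
  exists (`|p| + r); split=> [|M ltM x Kx]; first by rewrite num_real.
  apply: le_trans (ltW ltM); rewrite -[x](subKr p) (le_trans (ler_normB _ _))//.
  by rewrite lerD2l.
(* A cube of side [s] at [p] stays within distance n s < r of [p]; [n.+1] also covers [n = 0]. *)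
pose s := r / n.+1%:R.
have s0 : 0 < s by rewrite divr_gt0.
(* Each of the [n] directions contributes at most [2 * eta / s], together at most [e]. The side [s]
   is fixed before the increment is made small. *)
pose eta := e * s / (2 * n.+1%:R).
have eta0 : 0 < eta by rewrite divr_gt0// mulr_gt0.
(* Compactness of [K] turns joint convergence near each point into smallness uniform on [K]. *)
have TK : \forall h \near dnbhs (0 : R), K `<=` [set x | forall i, `|T i h x| <= eta].
  move/compact_near_coveringP : cK; apply => x /KVB[Vx _].
  suff H i : filter_prod (nbhs x) (dnbhs (0 : R)) [set z | `|T i z.2 z.1| <= eta].
    exact: (@filter_forall _ _ _ _ (filter_prod_filter _ _) H).
  have := T1 i x Vx; rewrite X0//.
  move/(@cvgrPdist_le _ _ _ _ (@filter_filter _ _ (jfilter_proper x))) => /(_ _ eta0).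
  move=> [[A' B'] /= [HA' HB'] AB'].
  exists (B', A') => //= -[y h] /= [By Ah].
  by have := AB' (h, y) (conj Ah By); rewrite sub0r normrN.
have : nbhs (0 : R) [set h | h != 0 ->
    (K `<=` [set x | forall i, `|T i h x| <= eta]) /\ A h] by exact: filterI TK HA.
move=> /nbhs_ballP[d /= d0 Hd].
(* With [m] steps the increment [s / m] is below [d] and fills the side exactly. *)
pose m := (Num.truncn (s / d)).+1.
have mR : 0 < m%:R :> R by rewrite ltr0n.
have sm0 : 0 < s / m%:R by rewrite divr_gt0.
have smd : s / m%:R < d.
  by rewrite ltr_pdivrMr// mulrC -ltr_pdivrMr// truncnS_gt.
have [|Th Ah] := Hd (s / m%:R) _ (lt0r_neq0 sm0).
  by rewrite /ball /= sub0r normrN gtr0_norm.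
have msE : m%:R * (s / m%:R) = s by rewrite mulrC divfK ?gt_eqF.
have inK y : `|y - p| <= s * n%:R -> K y.
  rewrite distrC => /le_trans; apply.
  by rewrite /s -mulrA (ler_piMr (ltW r0))// ler_pdivrMl// mulr1 ler_nat.
have inK' y : `|y - p| <= m%:R * (s / m%:R) * (size (enum 'I_n))%:R -> K y.
  by rewrite msE size_enum_ord; exact: inK.
pose G y := \sum_i dquot i (T i (s / m%:R)) (s / m%:R) y.
have B1 : `|avgs m (s / m%:R) (enum 'I_n) G p - rho| <= e.
  apply: avgs_bound => // y /inK' Ky; rewrite distrC.
  by apply: (AB (_, y)); split => //=; have [] := KVB _ Ky.
have B2 : `|avgs m (s / m%:R) (enum 'I_n) G p| <= e.
  rewrite avgs_sum (le_trans (ler_norm_sum _ _ _))//.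
  have H i : `|avgs m (s / m%:R) (enum 'I_n) (dquot i (T i (s / m%:R)) (s / m%:R)) p|
      <= 2 * eta / s.
    rewrite -[X in _ <= _ / X]msE; apply: avgs_dquot_bound => //; first by rewrite mem_enum.
    by move=> y /inK' /Th.
  apply: le_trans (ler_sum _ (fun i _ => H i)) _.
  rewrite sumr_const card_ord -[leLHS]mulr_natl /eta.
  have -> : n%:R * (2 * (e * s / (2 * n.+1%:R)) / s) = (n%:R / n.+1%:R) * e.
    by field; rewrite nat1r pnatr_eq0 (gt_eqF s0).
  by rewrite (ler_piMl (ltW e0))// ler_pdivrMr// mul1r ler_nat.
have := ler_normB (avgs m (s / m%:R) (enum 'I_n) G p) (avgs m (s / m%:R) (enum 'I_n) G p - rho).
rewrite subKr => /le_trans/(_ (lerD B2 B1)).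
have : 0 < `|rho| by rewrite normr_gt0.
rewrite /e; lra.
Unshelve. all: by end_near. Qed.

Lemma wdiv_unique V X (rho rho' : R) p : open V -> V p ->
  wdiv V X rho p -> wdiv V X rho' p -> rho = rho'.
Proof.
move=> oV Vp H H'; apply/eqP; rewrite -subr_eq0; apply/eqP.
by apply: wdiv0_eq0 oV Vp _ (wdivB H H') => i x _; rewrite subrr.
Qed.

End WeakDivergenceUnique.

(** * Differentiation of matrix-valued functions *)

Section StrictMatrices.
Variables (R : realType) (n : nat).
Implicit Types (p x : 'rV[R]_n).

Definition mstrict a b (A : 'rV[R]_n -> 'M[R]_(a, b)) p (dA : 'I_n -> 'M[R]_(a, b)) :=
  forall k l, strict (fun x => A x k l) p (fun i => dA i k l).

Lemma mstrict_eq a b (A : 'rV[R]_n -> 'M[R]_(a, b)) p dA dA' :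
  (forall i, dA i = dA' i) -> mstrict A p dA -> mstrict A p dA'.
Proof. by move=> e H k l; apply: strict_eq _ (H k l) => i; rewrite e. Qed.

Lemma mstrict_near a b (A B : 'rV[R]_n -> 'M[R]_(a, b)) p dA :
  (\forall x \near p, A x = B x) -> mstrict A p dA -> mstrict B p dA.
Proof.
move=> e H k l; apply: strict_near (H k l).
by apply: filterS e => x ->.
Qed.

Lemma mstrict_unique a b (A : 'rV[R]_n -> 'M[R]_(a, b)) p dA dA' :
  mstrict A p dA -> mstrict A p dA' -> forall i, dA i = dA' i.
Proof.
by move=> H H' i; apply/matrixP => k l; exact: strict_unique (H k l) (H' k l) i.
Qed.

Lemma mstrict_cst a b (A : 'M[R]_(a, b)) p : mstrict (fun _ => A) p (fun _ => 0).
Proof.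
by move=> k l; apply: strict_eq _ (@strict_cst _ _ p (A k l)) => i; rewrite mxE.
Qed.

Lemma mstrictD a b (A B : 'rV[R]_n -> 'M[R]_(a, b)) p dA dB :
  mstrict A p dA -> mstrict B p dB ->
  mstrict (fun x => A x + B x) p (fun i => dA i + dB i).
Proof.
move=> H H' k l; apply: strict_eq _ (strict_ext _ (strictD (H k l) (H' k l))) => i;
  by rewrite mxE.
Qed.

Lemma mstrictN a b (A : 'rV[R]_n -> 'M[R]_(a, b)) p dA :
  mstrict A p dA -> mstrict (fun x => - A x) p (fun i => - dA i).
Proof.
by move=> H k l; apply: strict_eq _ (strict_ext _ (strictN (H k l))) => i; rewrite mxE.
Qed.

Lemma mstrict_tr a b (A : 'rV[R]_n -> 'M[R]_(a, b)) p dA :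
  mstrict A p dA -> mstrict (fun x => (A x)^T) p (fun i => (dA i)^T).
Proof.
by move=> H k l; apply: strict_eq _ (strict_ext _ (H l k)) => i; rewrite mxE.
Qed.

Lemma mstrictM a b c (A : 'rV[R]_n -> 'M[R]_(a, b)) (B : 'rV[R]_n -> 'M[R]_(b, c)) p dA dB :
  mstrict A p dA -> mstrict B p dB ->
  mstrict (fun x => A x *m B x) p (fun i => dA i *m B p + A p *m dB i).
Proof.
move=> H H' k l.
have K := strict_sum (index_enum 'I_b) (fun j => strictM (H k j) (H' j l)).
apply: strict_eq _ (strict_ext _ K) => i; last by rewrite mxE.
by rewrite !mxE -big_split.
Qed.

(** Each term is a full product with one factor replaced, the form in which [strict_det] recognizes
    a determinant with one row replaced. *)
Lemma strict_prod (I : eqType) (r : seq I) (f : I -> 'rV[R]_n -> R) p (d : I -> 'I_n -> R) :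
  uniq r -> (forall k, strict (f k) p (d k)) ->
  strict (fun x => \prod_(k <- r) f k x) p
    (fun i => \sum_(k <- r) \prod_(l <- r) (if l == k then d l i else f l p)).
Proof.
move=> ur H; elim: r ur => [_|a r IH /= /andP[ar /IH {}IH]].
  apply: strict_eq _ (strict_ext _ (@strict_cst _ _ p 1)) => i; by rewrite big_nil.
apply: strict_eq _ (strict_ext _ (strictM (H a) IH)) => i; last by rewrite big_cons.
rewrite /= big_cons big_cons eqxx; congr (_ * _ + _).
  by apply: eq_big_seq => l lr; case: eqP => // e; rewrite -e lr in ar.
rewrite mulr_sumr; apply: eq_big_seq => k kr; rewrite big_cons.
by case: eqP => // e; rewrite e kr in ar.
Qed.

(** Jacobi's formula: differentiating the factors from row [k] gives the determinant with that row
    replaced by its derivative, and expansion along the row produces the adjugate. *)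
Lemma strict_det m (A : 'rV[R]_n -> 'M[R]_m) p dA : mstrict A p dA ->
  strict (fun x => \det (A x)) p (fun i => \tr (dA i *m \adj (A p))).
Proof.
move=> H; pose ie := index_enum 'I_m.
have K := strict_sum (index_enum {perm 'I_m}) (fun s : {perm 'I_m} => strictM
  (@strict_cst _ _ p ((-1) ^+ s)) (strict_prod (index_enum_uniq 'I_m) (fun k => H k (s k)))).
apply: strict_eq _ K => i.
under eq_bigr do rewrite mul0r add0r mulr_sumr.
rewrite exchange_big /mxtrace; apply: eq_bigr => k _ /=.
pose B := \matrix_(l, j) (if l == k then dA i l j else A p l j).
have -> : \sum_(s : {perm 'I_m}) (-1) ^+ s *
    (\prod_l (if l == k then dA i l (s l) else A p l (s l))) = \det B.
  by apply: eq_bigr => s _; congr (_ * _); apply: eq_bigr => l _; rewrite mxE.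
rewrite (expand_det_row _ k) mxE; apply: eq_bigr => j _; rewrite !mxE eqxx.
congr (_ * (_ * \det _)); apply/matrixP => a b; rewrite !mxE.
by rewrite eq_sym (negbTE (neq_lift _ _)).
Qed.

(** Cramer's rule shows that the inverse is strictly differentiable; its derivative is then read off
    from the product with [A] being 1. *)
Lemma mstrict_inv m (A : 'rV[R]_n -> 'M[R]_m) p dA : A p \in unitmx -> mstrict A p dA ->
  mstrict (fun x => invmx (A x)) p (fun i => - (invmx (A p) *m dA i *m invmx (A p))).
Proof.
move=> Au H.
have dn0 : \det (A p) != 0 by rewrite -unitfE.
have sd := strict_det H; have [cd _] := sd.
have nu : \forall x \near p, A x \in unitmx.
  near=> x; rewrite unitmxE unitfE; near: x; exact: (@cvgr_neq0 _ _ _ _ (nbhs_filter p) _ _ cd dn0).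
have [dI HI] : exists dI, mstrict (fun x => invmx (A x)) p dI.
  have Hkl (kl : 'I_m * 'I_m) : exists d : 'I_n -> R,
      strict (fun x => invmx (A x) kl.1 kl.2) p d.
    have Hs : mstrict (fun x => row' kl.2 (col' kl.1 (A x))) p
        (fun i => row' kl.2 (col' kl.1 (dA i))).
      move=> a b; apply: strict_eq _ (strict_ext _ (H (lift kl.2 a) (lift kl.1 b))) => i;
        by rewrite !mxE.
    eexists; apply: strict_near (strictM (strictV dn0 sd)
      (strictM (@strict_cst _ _ p ((-1) ^+ (kl.2 + kl.1))) (strict_det Hs))).
    by apply: filterS nu => x xu; rewrite /invmx xu !mxE.
  have /choice[d Hd] := Hkl.
  exists (fun i => \matrix_(k, l) d (k, l) i) => k l.
  by apply: strict_eq _ (Hd (k, l)) => i; rewrite mxE.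
have H1 := mstrictM H HI.
have H0 : mstrict (fun x => A x *m invmx (A x)) p (fun=> 0).
  apply: mstrict_near (mstrict_cst 1%:M p).
  by apply: filterS nu => x xu; rewrite mulmxV.
apply: mstrict_eq _ HI => i.
have /(congr1 (mulmx (invmx (A p)))) := mstrict_unique H1 H0 i.
by rewrite mulmxDr mulmx0 mulKmx// mulmxA => /eqP; rewrite addrC addr_eq0 => /eqP.
Unshelve. all: by end_near. Qed.

End StrictMatrices.

(** * Gram matrices and the splitting into tangent and normal parts *)

Section GramMatrices.
Variable R : realType.

Lemma mxtrace_gram_eq0 a b (P : 'M[R]_(a, b)) : \tr (P *m P^T) = 0 -> P = 0.
Proof.
move=> /eqP; rewrite /mxtrace.
under eq_bigr => i _ do rewrite mxE.
under eq_bigr => i _ do under eq_bigr => j _ do rewrite mxE -expr2.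
rewrite psumr_eq0; last by move=> i _; apply: sumr_ge0 => j _; exact: sqr_ge0.
move=> /allP H; apply/matrixP => i j; rewrite mxE.
have := H i (mem_index_enum _); rewrite psumr_eq0; last by move=> ? _; exact: sqr_ge0.
by move=> /allP /(_ j (mem_index_enum _)); rewrite sqrf_eq0 => /eqP.
Qed.

Lemma mxtrace_gram_ge0 a b (P : 'M[R]_(a, b)) : 0 <= \tr (P *m P^T).
Proof.
apply: sumr_ge0 => i _; rewrite mxE; apply: sumr_ge0 => j _.
by rewrite mxE -expr2 sqr_ge0.
Qed.

Lemma gram_unitmx a b (J : 'M[R]_(a, b)) : row_free J -> J *m J^T \in unitmx.
Proof.
move=> fJ; rewrite -row_free_unit -kermx_eq0; apply/eqP/row_matrixP => i.
rewrite row0; set v := row i _.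
have vJ : v *m (J *m J^T) = 0 by rewrite -row_mul mulmx_ker row0.
have : v *m J = 0.
  by apply: mxtrace_gram_eq0; rewrite trmx_mul mulmxA -(mulmxA v) vJ mul0mx mxtrace0.
by move/eqP; rewrite mulmx_free_eq0// => /eqP.
Qed.

Variables (n : nat) (J : 'M[R]_(n, n.+1)) (N : 'rV[R]_n.+1).
Hypotheses (fJ : row_free J) (JN : J *m N^T = 0) (NN : N *m N^T = 1%:M).

Let G := J *m J^T.
Let Gu : G \in unitmx := gram_unitmx fJ.

Lemma gram_invmx_sym : (invmx G)^T = invmx G.
Proof. by rewrite trmx_inv trmx_mul trmxK. Qed.

(** The defect from the identity is a symmetric idempotent, so its trace is its squared Frobenius
    norm; that trace is (n + 1) - n - 1 = 0. *)
Lemma tangent_normal_decomposition : J^T *m invmx G *m J + N^T *m N = 1%:M.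
Proof.
apply/eqP; rewrite -subr_eq0 -oppr_eq0 opprB; apply/eqP.
set P := _ - _.
have NJ : N *m J^T = 0 by rewrite -[LHS]trmxK trmx_mul trmxK JN trmx0.
have PJ : P *m J^T = 0.
  by rewrite mulmxBl mulmxDl mul1mx -!mulmxA mulVmx// mulmx1 NJ mulmx0 addr0 subrr.
have PN : P *m N^T = 0.
  by rewrite mulmxBl mulmxDl mul1mx -!mulmxA JN NN !mulmx0 mulmx1 add0r subrr.
have PT : P^T = P.
  by rewrite /P raddfB raddfD /= trmx1 !trmx_mul !trmxK gram_invmx_sym mulmxA.
have PP : P *m P^T = P.
  by rewrite PT {2}/P mulmxBr mulmx1 mulmxDr !mulmxA PJ PN !mul0mx addr0 subr0.
apply: mxtrace_gram_eq0; rewrite PP /P raddfB raddfD /=.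
rewrite mxtrace1 mxtrace_mulC mulmxA mulmxV// mxtrace1 mxtrace_mulC NN mxtrace1.
by rewrite -natrD addn1 subrr.
Qed.

End GramMatrices.

Lemma unit_normal_exists (R : realType) n (J : 'M[R]_(n, n.+1)) :
  exists N : 'rV[R]_n.+1, J *m N^T = 0 /\ N *m N^T = 1%:M.
Proof.
have k0 : kermx J^T != 0.
  by rewrite kermx_eq0 -row_leq_rank -ltnNge ltnS rank_leq_col.
have /rowV0Pn[v /sub_kermxP vJ v0] := k0.
have vv : v *m v^T = (\tr (v *m v^T))%:M by rewrite {1}[v *m v^T]mx11_scalar trace_mx11.
have t0 : 0 < \tr (v *m v^T).
  rewrite lt_neqAle mxtrace_gram_ge0 andbT eq_sym.
  by apply: contra v0 => /eqP /mxtrace_gram_eq0 ->.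
exists ((Num.sqrt (\tr (v *m v^T)))^-1 *: v); split.
  by rewrite linearZ /= -scalemxAr -[J]trmxK -trmx_mul vJ trmx0 scaler0.
rewrite linearZ /= -scalemxAl -scalemxAr scalerA -expr2 exprVn sqr_sqrtr ?(ltW t0)//.
by rewrite {2}vv scale_scalar_mx mulVf// gt_eqF.
Qed.

(* Bordering J by a unit normal makes it square. *)
Lemma det_gram_gt0 (R : realType) n (J : 'M[R]_(n, n.+1)) :
  row_free J -> 0 < \det (J *m J^T).
Proof.
move=> fJ; have [N [JN NN]] := unit_normal_exists J.
have dge0 a b (e : a = b) (B : 'M[R]_(a, b)) : 0 <= \det (B *m B^T).
  by case: b / e B => B; rewrite det_mulmx det_tr -expr2 sqr_ge0.
rewrite lt_neqAle eq_sym -unitfE -unitmxE gram_unitmx//=.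
have := dge0 _ _ (addn1 n) (col_mx J N).
rewrite tr_col_mx mul_col_row JN NN.
have -> : N *m J^T = 0 by rewrite -[LHS]trmxK trmx_mul trmxK JN trmx0.
by rewrite det_ublock det1 mulr1.
Qed.

Lemma cvg_sumr (T I : Type) (R : realType) (F : set_system T) (FF : Filter F)
    (r : seq I) (f : I -> T -> R) (l : I -> R) :
  (forall k, f k t @[t --> F] --> l k) ->
  \sum_(k <- r) f k t @[t --> F] --> \sum_(k <- r) l k.
Proof.
move=> H; apply: (@cvg_big _ _ _ _ xpredT _ _ _ r f l FF); first exact: add_continuous.
by move=> k _; exact: H.
Qed.

Lemma continuous_at_sum (T : topologicalType) (R : realType) (I : Type) (r : seq I)
    (f : I -> T -> R) (x : T) : (forall k, {for x, continuous (f k)}) ->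
  {for x, continuous (fun y => \sum_(k <- r) f k y)}.
Proof. exact: cvg_sumr. Qed.

(** * Local geometry of a C^2 immersion *)

Section LocalGeometry.
Variables (R : realType) (n : nat) (V : set 'rV[R]_n).
Hypothesis oV : open V.
Implicit Types (i j : 'I_n) (p x : 'rV[R]_n).

(** Take the constant skew matrix [c] with 1 at (i, j) and -1 at (j, i). The field c grad f has weak
    divergence 0 by [wdiv_skew] and classical divergence [ddf j i - ddf i j]; uniqueness equates
    them. *)
Lemma strict_schwarz (f : 'rV[R]_n -> R) (df : 'I_n -> 'rV[R]_n -> R) ddf p :
  V p -> (forall x, V x -> strict f x (df^~ x)) ->
  (forall x i, V x -> {for x, continuous (df i)}) ->
  (forall j, strict (df j) p (ddf j)) -> forall i j, ddf j i = ddf i j.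
Proof.
move=> Vp sf cf sdf i j.
pose c (a b : 'I_n) : R := ((a == i) && (b == j))%:R - ((a == j) && (b == i))%:R.
have W1 := wdiv_skew (C := fun a b _ => c a b) (dC := fun _ _ _ => 0) Vp _ _ _ sf.
have {}W1 : wdiv V (fun a x => \sum_b c a b * df b x) 0 p.
  apply: wdiv_ext (W1 _ _ _) => //.
  - by rewrite big1 // => a _; rewrite big1 // => b _; rewrite mul0r.
  - by move=> a b x; rewrite /c opprB; congr (_%:R - _%:R); rewrite andbC.
  - by move=> a b x _; exact: cst_continuous.
  - by move=> a b; exact: strict_cst.
have W2 : wdiv V (fun a x => \sum_b c a b * df b x)
    (\sum_a \sum_b (0 * df b p + c a b * ddf b a)) p.
  apply: (wdiv_strict (d := fun a k => \sum_b (0 * df b p + c a b * ddf b k))).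
    move=> a x Vx; apply: continuous_at_sum => b.
    by apply: continuousM; [exact: cst_continuous|exact: cf].
  by move=> a; apply: strict_sum => b; exact: strictM (strict_cst _ _) (sdf b).
have := wdiv_unique oV Vp W1 W2.
have E (a b : 'I_n) : \sum_k \sum_l ((k == a) && (l == b))%:R * ddf l k = ddf b a.
  rewrite (bigD1 a)//= (bigD1 b)//= !eqxx mul1r !big1 ?addr0// => k /negbTE.
    by move=> ka; rewrite big1// => l _; rewrite ka mul0r.
  by move=> ->; rewrite andbF mul0r.
move=> H; apply/eqP; rewrite -subr_eq0; apply/eqP; apply: etrans (esym H).
rewrite -[ddf j i]E -[ddf i j]E -sumrB.
by apply: eq_bigr => a _; rewrite -sumrB; apply: eq_bigr => b _; rewrite mul0r add0r /c mulrBl.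
Qed.

Variables (Phi : 'rV[R]_n -> 'rV[R]_n.+1) (N : 'rV[R]_n -> 'rV[R]_n.+1).
Hypothesis Phi2 : forall l, Ck 2 V (fun y => Phi y ord0 l).
Hypothesis fJ : forall x, V x -> row_free (Defs.jacobian Phi x).
Hypothesis cN : forall x l, V x -> {for x, continuous (fun y => N y ord0 l)}.
Hypothesis NN1 : forall x, V x -> dotv (N x) (N x) = 1.
Hypothesis TN0 : forall x i, V x -> dotv (tangent Phi i x) (N x) = 0.

Notation J := (Defs.jacobian Phi).

Definition hess i x : 'M[R]_(n, n.+1) :=
  \matrix_(k, l) partial i (partial k (fun y => Phi y ord0 l)) x.

Lemma dotvE a (u v : 'rV[R]_a) : dotv u v = (u *m v^T) ord0 ord0.
Proof. by rewrite mxE; apply: eq_bigr => l _; rewrite mxE. Qed.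

Lemma jacobian_strict x : V x -> mstrict J x (hess^~ x).
Proof.
move=> Vx k l; have [_ /(_ k) H] := Ck2_strict oV Vx (Phi2 l).
by apply: strict_eq _ (strict_ext _ H) => [i|y]; rewrite !mxE.
Qed.

Lemma hess_sym i j x l : V x -> hess i x j l = hess j x i l.
Proof.
move=> Vx; pose f y := Phi y ord0 l; rewrite [LHS]mxE [RHS]mxE.
have sf y : V y -> strict f y (fun k => partial k f y).
  by move=> Vy; exact: (Ck2_strict oV Vy (Phi2 l)).1.
have sd y : V y -> forall k, strict (partial k f) y (fun m => partial m (partial k f) y).
  by move=> Vy; exact: (Ck2_strict oV Vy (Phi2 l)).2.
have H := strict_schwarz (df := fun k => partial k f)
  (ddf := fun k m => partial m (partial k f) x) Vx sf _ (sd x Vx).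
by apply: H => y k Vy; exact: (sd y Vy k).1.
Qed.

Lemma first_formE x : first_form Phi x = J x *m (J x)^T.
Proof.
apply/matrixP => i j; rewrite !mxE; apply: eq_bigr => l _; by rewrite !mxE.
Qed.

Lemma second_form_entry x i j :
  second_form Phi (N x) x i j = \sum_l N x ord0 l * hess i x j l.
Proof.
by rewrite mxE; apply: eq_bigr => l _; rewrite mulrC; congr (_ * _); rewrite [LHS]mxE [RHS]mxE.
Qed.

Lemma second_formE x i : row i (second_form Phi (N x) x) = N x *m (hess i x)^T.
Proof.
apply/rowP => j; rewrite [LHS]mxE second_form_entry [RHS]mxE.
by apply: eq_bigr => l _; congr (_ * _); rewrite [RHS]mxE.
Qed.

Lemma second_form_sym x : V x -> (second_form Phi (N x) x)^T = second_form Phi (N x) x.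
Proof.
move=> Vx; apply/matrixP => i j; rewrite [LHS]mxE !second_form_entry.
by apply: eq_bigr => l _; congr (_ * _); exact: hess_sym.
Qed.

Lemma tangent_normal0 x : V x -> J x *m (N x)^T = 0.
Proof.
move=> Vx; apply/matrixP => i k; rewrite !mxE -[RHS](TN0 i Vx).
by apply: eq_bigr => l _; rewrite !mxE (ord1 k).
Qed.

Lemma normal_unit x : V x -> N x *m (N x)^T = 1%:M.
Proof.
move=> Vx; apply/matrixP => a b; rewrite !ord1 -dotvE NN1// mxE eqxx.
by [].
Qed.

Let frame x (Vx : V x) := tangent_normal_decomposition (fJ Vx) (tangent_normal0 Vx) (normal_unit Vx).

Lemma first_form_unit x : V x -> first_form Phi x \in unitmx.
Proof. by move=> Vx; rewrite first_formE; exact: gram_unitmx (fJ Vx). Qed.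

Lemma first_form_strict x : V x -> mstrict (first_form Phi) x
  (fun i => hess i x *m (J x)^T + J x *m (hess i x)^T).
Proof.
move=> Vx; have sJ := jacobian_strict Vx.
apply: mstrict_near _ (mstrictM sJ (mstrict_tr sJ)).
by near=> y; rewrite first_formE.
Unshelve. all: by end_near. Qed.

(* Close to x, N is the normalized component of N x orthogonal to the tangent
   plane, an expression in first derivatives of Phi only. *)
Lemma normal_strict x : V x -> exists dN, mstrict N x dN.
Proof.
move=> Vx.
pose w y := N x - N x *m ((J y)^T *m invmx (first_form Phi y) *m J y).
pose q y := (w y *m (N x)^T) ord0 ord0.
have sJ := jacobian_strict Vx.
have [dw sw] : exists dw, mstrict w x dw.
  eexists; apply: (mstrictD (mstrict_cst (N x) x) (mstrictN
    (mstrictM (mstrict_cst (N x) x) (mstrictM (mstrictM (mstrict_tr sJ)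
    (mstrict_inv (first_form_unit Vx) (first_form_strict Vx))) sJ)))).
have sq := mstrictM sw (mstrict_cst (N x)^T x) ord0 ord0.
have wE y : V y -> w y = (N x *m (N y)^T) ord0 ord0 *: N y.
  move=> Vy; rewrite -mul_scalar_mx -mx11_scalar -mulmxA.
  by rewrite /w first_formE -{1}[N x]mulmx1 -(frame Vy) mulmxDr addrAC subrr add0r.
have qE y : V y -> q y = (N x *m (N y)^T) ord0 ord0 ^+ 2.
  move=> Vy; rewrite /q wE// -scalemxAl mxE expr2; congr (_ * _).
  have -> : N y *m (N x)^T = (N x *m (N y)^T)^T by rewrite trmx_mul trmxK.
  by rewrite [LHS]mxE.
have qx : q x = 1 by rewrite qE// normal_unit// mxE eqxx expr1n.
have q0 : 0 < q x by rewrite qx.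
have s0 : Num.sqrt (q x) != 0 by rewrite qx sqrtr1 oner_neq0.
have sV := strictV s0 (strict_sqrt q0 sq).
(* The square root of [q y] gives only the absolute value of the product of [N x] and [N y];
   continuity of [N] fixes its sign near [x]. *)
have cpos : \forall y \near x, 0 < (N x *m (N y)^T) ord0 ord0.
  have cc : {for x, continuous (fun y => (N x *m (N y)^T) ord0 ord0)}.
    have -> : (fun y => (N x *m (N y)^T) ord0 ord0) =
        (fun y => \sum_l N x ord0 l * N y ord0 l).
      by apply/funext => y; rewrite -dotvE.
    apply: continuous_at_sum => l.
    by apply: continuousM; [exact: cst_continuous|exact: cN].
  by apply: (@cvgr_gt _ _ _ (nbhs_filter x) _ _ cc); rewrite normal_unit// mxE eqxx.
have Hl l : exists e : 'I_n -> R, strict (fun y => N y ord0 l) x e.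
  eexists; apply: strict_near (strictM sV (sw ord0 l)).
  near=> y.
  have Vy : V y by near: y; exact: open_nbhs_nbhs.
  have c0 : 0 < (N x *m (N y)^T) ord0 ord0 by near: y.
  by rewrite -/(q y) qE// wE// sqrtr_sqr (gtr0_norm c0) [X in _ * X]mxE mulKf ?gt_eqF.
have /choice[d Hd] := Hl.
exists (fun i => \row_l d l i) => k l; rewrite !ord1.
by apply: strict_eq _ (Hd l) => i; rewrite mxE.
Unshelve. all: by end_near. Qed.

End LocalGeometry.

(** * Algebra behind the divergence of the skew fields *)

Section DivergenceAlgebra.
Variables (R : comNzRingType) (n m : nat).
Variables (E D : 'M[R]_(n, m)) (dE : 'I_n -> 'M[R]_(n, m)) (dq : 'I_n -> R) (q : R).
Variables (Ga : 'I_n -> 'M[R]_n) (a : 'I_n -> 'cV[R]_n) (N : 'rV[R]_m) (l0 : 'I_m).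
Hypothesis dEE : forall i, dE i = a i *m N - Ga i *m E.
Hypothesis ND : N *m D^T = 0.
Hypothesis dqE : forall i, dq i = q * \tr (Ga i).
Hypothesis Gasym : forall i j k, Ga i j k = Ga k j i.

Let M := E *m D^T.
Let e : 'cV[R]_n := col l0 E.
Hypothesis trM : \tr M = 0.

(* In the application Ga holds the Christoffel symbols, which cancel by their
   symmetry. *)
Lemma divergence_contraction :
  \sum_i \sum_j \sum_l
    (dq i * (E j l * E i l0 - E i l * E j l0) +
     q * (dE i j l * E i l0 + E j l * dE i i l0 - (dE i i l * E j l0 + E i l * dE i j l0)))
    * D j l = - (q * N ord0 l0 * \sum_i (M *m a i) i ord0).
Proof.
have dED i : dE i *m D^T = - (Ga i *m M).
  by rewrite dEE mulmxBl -mulmxA ND mulmx0 sub0r -mulmxA.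
pose de i : 'cV[R]_n := col l0 (dE i).
have deE i : de i = N ord0 l0 *: a i - Ga i *m e.
  rewrite /de dEE raddfB /= !colE -!mulmxA -!colE; congr (_ - _).
  apply/colP => k; rewrite !mxE big_ord1 mulrC !mxE.
  by congr (_ * _).
(* Once [\tr M = 0] is used, five sums remain. The first cancels the second and the third cancels
   the fourth by the symmetry of [Ga] in its outer indices; only the normal part of [dE]
   survives. *)
transitivity (\sum_i (q * (\sum_k Ga i i k * (M *m e) k ord0)
   - q * \tr (Ga i) * (M *m e) i ord0 - q * \tr (Ga i *m M) * e i ord0
   + q * (\sum_j \sum_k M i j * Ga i j k * e k ord0)
   - q * N ord0 l0 * (M *m a i) i ord0)).
  apply: eq_bigr => i _.
  transitivity (\sum_j (dq i * (M j j * e i ord0 - M i j * e j ord0) +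
     q * ((dE i *m D^T) j j * e i ord0 + M j j * de i i ord0 -
       ((dE i *m D^T) i j * e j ord0 + M i j * de i j ord0)))).
    apply: eq_bigr => j _.
    have -> : M j j = \sum_l E j l * D j l by rewrite mxE; apply: eq_bigr => l _; rewrite mxE.
    have -> : M i j = \sum_l E i l * D j l by rewrite mxE; apply: eq_bigr => l _; rewrite mxE.
    have DD k : (dE i *m D^T) k j = \sum_l dE i k l * D j l.
      by rewrite mxE; apply: eq_bigr => l _; rewrite mxE.
    rewrite !DD.
    rewrite !mxE !mulr_suml -!big_split -!sumrB /= !mulr_sumr -!big_split /=.
    by apply: eq_bigr => l _; ring.
  rewrite !big_split /= -!mulr_sumr !sumrB !big_split /= -!mulr_suml.
  rewrite -/(mxtrace M) -/(mxtrace (dE i *m D^T)) trM !mul0r !sub0r addr0.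
  have -> : \sum_j M i j * e j ord0 = (M *m e) i ord0 by rewrite [RHS]mxE.
  have -> : \sum_j M i j * de i j ord0 = (M *m de i) i ord0 by rewrite [RHS]mxE.
  have -> : \sum_j (dE i *m D^T) i j * e j ord0 = (dE i *m D^T *m e) i ord0 by rewrite [RHS]mxE.
  rewrite dED deE dqE raddfN /= mulNmx -[Ga i *m M *m e]mulmxA mulmxBr -scalemxAr.
  have -> : \sum_j \sum_k M i j * Ga i j k * e k ord0 = (M *m (Ga i *m e)) i ord0.
    rewrite [RHS]mxE; apply: eq_bigr => j _; rewrite [X in _ = _ * X]mxE mulr_sumr.
    by apply: eq_bigr => k _; rewrite mulrA.
  have -> : \sum_k Ga i i k * (M *m e) k ord0 = (Ga i *m (M *m e)) i ord0 by rewrite [RHS]mxE.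
  move: (M *m a i) (M *m (Ga i *m e)) (Ga i *m (M *m e)) (M *m e) => A1 A2 A3 A4.
  by rewrite !mxE; ring.
rewrite !big_split /= !sumrN.
have -> : \sum_i q * (\sum_k Ga i i k * (M *m e) k ord0) =
          \sum_i q * \tr (Ga i) * (M *m e) i ord0.
  rewrite -mulr_sumr exchange_big mulr_sumr; apply: eq_bigr => k _ /=.
  by rewrite -mulrA -mulr_suml; congr (_ * (_ * _)); apply: eq_bigr => i _; rewrite Gasym.
have -> : \sum_i q * (\sum_j \sum_k M i j * Ga i j k * e k ord0) =
          \sum_i q * \tr (Ga i *m M) * e i ord0.
  rewrite -mulr_sumr.
  under eq_bigr => i _ do rewrite exchange_big /=.
  rewrite exchange_big mulr_sumr; apply: eq_bigr => k _ /=.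
  rewrite mxtrace_mulC -mulrA; congr (_ * _).
  rewrite /mxtrace mulr_suml; apply: eq_bigr => i _; rewrite [X in _ = X * _]mxE mulr_suml.
  by apply: eq_bigr => j _; rewrite (Gasym i).
by rewrite subrr sub0r addNr sub0r -mulr_sumr.
Qed.

End DivergenceAlgebra.

(** * Weak Jacobi equation for the unit normal *)

Section NormalDivergence.
Variables (R : realType) (n : nat) (V : set 'rV[R]_n).
Hypothesis oV : open V.
Variables (Phi : 'rV[R]_n -> 'rV[R]_n.+1) (N : 'rV[R]_n -> 'rV[R]_n.+1).
Hypothesis Phi2 : forall l, Ck 2 V (fun y => Phi y ord0 l).
Hypothesis fJ : forall x, V x -> row_free (Defs.jacobian Phi x).
Hypothesis NN1 : forall x, V x -> dotv (N x) (N x) = 1.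
Hypothesis TN0 : forall x i, V x -> dotv (tangent Phi i x) (N x) = 0.
Variable dN : 'I_n -> 'rV[R]_n -> 'rV[R]_n.+1.
Hypothesis sN : forall x, V x -> mstrict N x (dN^~ x).
Implicit Types (i j : 'I_n) (p x : 'rV[R]_n).

Notation J := (Defs.jacobian Phi).
Notation Gi x := (invmx (first_form Phi x)).
Notation h x := (second_form Phi (N x) x).

Definition dnormal x : 'M[R]_(n, n.+1) := \matrix_(j, l) dN j x ord0 l.

Definition dual_frame x : 'M[R]_(n, n.+1) := Gi x *m J x.

Definition volume x : R := Num.sqrt (\det (first_form Phi x)).

Let JN x : V x -> J x *m (N x)^T = 0 := tangent_normal0 TN0 (x := x).
Let NN x : V x -> N x *m (N x)^T = 1%:M := normal_unit NN1 (x := x).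
Let Gu x : V x -> first_form Phi x \in unitmx := first_form_unit fJ (x := x).

Let frame x : V x -> (J x)^T *m Gi x *m J x + (N x)^T *m N x = 1%:M.
Proof.
move=> Vx; have := tangent_normal_decomposition (fJ Vx) (JN Vx) (NN Vx).
by rewrite first_formE.
Qed.

Let GiT x : (Gi x)^T = Gi x.
Proof. by rewrite first_formE gram_invmx_sym. Qed.

Let nearV x : V x -> \forall y \near x, V y.
Proof. by move=> Vx; exact: open_nbhs_nbhs. Qed.

Lemma row_dnormal x j : row j (dnormal x) = dN j x.
Proof. by apply/rowP => l; rewrite !mxE. Qed.

Lemma dnormal_normal x : V x -> dnormal x *m (N x)^T = 0.
Proof.
move=> Vx; apply/row_matrixP => j; rewrite row_mul row_dnormal row0.
have H := mstrictM (sN Vx) (mstrict_tr (sN Vx)).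
have H0 : mstrict (fun y => N y *m (N y)^T) x (fun=> 0).
  apply: mstrict_near _ (mstrict_cst 1%:M x).
  by apply: filterS (nearV Vx) => y Vy; rewrite NN.
have := mstrict_unique H H0 j.
have -> : N x *m (dN j x)^T = (dN j x *m (N x)^T)^T by rewrite trmx_mul trmxK.
move/matrixP => E; apply/matrixP => a b; have := E a b.
rewrite mxE [X in _ + X]mxE !ord1 -mulr2n => /eqP.
by rewrite [X in _ == X]mxE mulrn_eq0 /= => /eqP ->; rewrite mxE.
Qed.

Lemma weingarten x : V x -> dnormal x = - (h x *m dual_frame x).
Proof.
move=> Vx; rewrite -[LHS]mulmx1 -(frame Vx) mulmxDr !mulmxA dnormal_normal// mul0mx addr0.
rewrite -!mulNmx; congr (_ *m _ *m _).
apply/row_matrixP => j; rewrite row_mul row_dnormal raddfN /= second_formE.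
have H := mstrictM (sN Vx) (mstrict_tr (jacobian_strict oV Phi2 Vx)).
have H0 : mstrict (fun y => N y *m (J y)^T) x (fun=> 0).
  apply: mstrict_near _ (mstrict_cst 0 x).
  apply: filterS (nearV Vx) => y Vy.
  by rewrite -[N y]trmxK -trmx_mul JN// trmx0.
by have /eqP := mstrict_unique H H0 j; rewrite addr_eq0 => /eqP.
Qed.

Let N_dnormal x : V x -> N x *m (dnormal x)^T = 0.
Proof. by move=> Vx; rewrite -[LHS]trmxK trmx_mul trmxK dnormal_normal// trmx0. Qed.

Definition christoffel i x : 'M[R]_n := dual_frame x *m (hess Phi i x)^T.

Lemma christoffel_sym x i j k : V x -> christoffel i x j k = christoffel k x j i.
Proof.
move=> Vx; rewrite /christoffel [LHS]mxE [RHS]mxE; apply: eq_bigr => l _.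
by congr (_ * _); rewrite [LHS]mxE [RHS]mxE; exact: (hess_sym oV Phi2 i k l Vx).
Qed.

(** [frame] splits the second derivatives of [Phi] into tangential and normal parts; the tangential
    part cancels one of the two terms from the derivative of the inverse metric. *)
Lemma dual_frame_strict x : V x -> mstrict dual_frame x
  (fun i => Gi x *m hess Phi i x *m (N x)^T *m N x - christoffel i x *m dual_frame x).
Proof.
move=> Vx; have sJ := jacobian_strict oV Phi2 Vx.
apply: mstrict_eq _ (mstrictM (mstrict_inv (Gu Vx) (first_form_strict oV Phi2 Vx)) sJ) => i.
have e : (N x)^T *m N x = 1%:M - (J x)^T *m Gi x *m J x by rewrite -(frame Vx) addrC addKr.
rewrite -(mulmxA (_ *m _) (N x)^T) e mulmxBr mulmx1 /christoffel /dual_frame.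
by rewrite mulNmx mulmxDr !mulmxDl !mulmxA opprD addrC addrA.
Qed.

Lemma volume_gt0 x : V x -> 0 < volume x.
Proof.
move=> Vx; rewrite sqrtr_gt0 first_formE.
exact: det_gram_gt0 (fJ Vx).
Qed.

(** Jacobi's formula: the two terms in the derivative of the metric have the same trace against its
    inverse, which absorbs the 2 from the square root. *)
Lemma volume_strict x : V x -> strict volume x (fun i => volume x * \tr (christoffel i x)).
Proof.
move=> Vx; have v0 := volume_gt0 Vx.
have d0 : 0 < \det (first_form Phi x) by rewrite -sqrtr_gt0.
apply: strict_eq _ (strict_sqrt d0 (strict_det (first_form_strict oV Phi2 Vx))) => i.
rewrite -/(volume x).
have -> : \adj (first_form Phi x) = volume x ^+ 2 *: Gi x.
  by rewrite /invmx Gu// scalerA sqr_sqrtr ?ltW// mulfV ?scale1r ?gt_eqF.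
rewrite -scalemxAr mxtraceZ mulmxDl raddfD /=.
have -> : \tr (hess Phi i x *m (J x)^T *m Gi x) = \tr (christoffel i x).
  by rewrite -mxtrace_tr !trmx_mul trmxK GiT /christoffel /dual_frame mulmxA.
have -> : \tr (J x *m (hess Phi i x)^T *m Gi x) = \tr (christoffel i x).
  by rewrite mxtrace_mulC /christoffel /dual_frame mulmxA.
by field; rewrite gt_eqF.
Qed.

Hypothesis H0 : forall x, V x -> mean_curvature Phi (N x) x = 0.

Definition grad_normal l i x : R := \sum_j Gi x i j * dN j x ord0 l.

(** Up to the factor, a 2x2 minor of the dual frame in columns [l] and [l0]: skew in [i] and [j], as
    [wdiv_skew] requires. *)
Let C l0 l i j x : R := - (volume x *
  (dual_frame x j l * dual_frame x i l0 - dual_frame x i l * dual_frame x j l0)).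

Let shapeE x : V x -> dual_frame x *m (dnormal x)^T = - Defs.shape Phi (N x) x.
Proof.
move=> Vx; rewrite weingarten// raddfN /= mulmxN trmx_mul (second_form_sym oV N Phi2 Vx).
congr (- _); rewrite /Defs.shape mulmxA; congr (_ *m _).
rewrite /dual_frame trmx_mul GiT mulmxA -(mulmxA (Gi x)) -first_formE mulVmx ?Gu//.
by rewrite mul1mx.
Qed.

Let trace_frame x : V x -> \tr (dual_frame x *m (dnormal x)^T) = 0.
Proof.
by move=> Vx; rewrite shapeE// raddfN /= -/(mean_curvature _ _ _) H0// oppr0.
Qed.

(** With E the dual frame, the contraction is a multiple of tr(M) E - M E. Minimality removes the
    first term, and the Weingarten equation turns the second into the gradient. *)
Let sum_C l0 i x : V x ->
  \sum_l \sum_j C l0 l i j x * dN j x ord0 l = volume x * grad_normal l0 i x.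
Proof.
move=> Vx; set M := dual_frame x *m (dnormal x)^T.
transitivity (- volume x * (\tr M * dual_frame x i l0 - (M *m dual_frame x) i l0)).
  rewrite exchange_big /= /mxtrace mulr_suml [X in _ = _ * (_ - X)]mxE -sumrB mulr_sumr.
  apply: eq_bigr => j _; rewrite [M j j]mxE [M i j]mxE !mulr_suml -sumrB mulr_sumr.
  by apply: eq_bigr => l _; rewrite /C !mxE; ring.
rewrite trace_frame// mul0r sub0r mulrNN; congr (_ * _).
have -> : M *m dual_frame x = Gi x *m dnormal x.
  by rewrite /M shapeE// weingarten// mulNmx mulmxN /Defs.shape -(mulmxA (Gi x) (h x)).
by rewrite mxE; apply: eq_bigr => j _; rewrite [dnormal x _ _]mxE.
Qed.

(* The weak form of Delta nu = - |A|^2 nu on a minimal hypersurface. *)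
Lemma wdiv_grad_normal l0 p : V p ->
  wdiv V (fun i x => volume x * grad_normal l0 i x)
    (- (volume p * sqnorm_A Phi (N p) p * N p ord0 l0)) p.
Proof.
move=> Vp.
pose dE i x := Gi x *m hess Phi i x *m (N x)^T *m N x - christoffel i x *m dual_frame x.
pose dC l i j k := - (volume p * \tr (christoffel k p) *
    (dual_frame p j l * dual_frame p i l0 - dual_frame p i l * dual_frame p j l0) +
  volume p * (dE k p j l * dual_frame p i l0 + dual_frame p j l * dE k p i l0
    - (dE k p i l * dual_frame p j l0 + dual_frame p i l * dE k p j l0))).
have sC l i j : strict (C l0 l i j) p (dC l i j).
  have sE := dual_frame_strict Vp.
  exact: strictN (strictM (volume_strict Vp)
    (strictD (strictM (sE j l) (sE i l0)) (strictN (strictM (sE i l) (sE j l0))))).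
have cC l i j x : V x -> {for x, continuous (C l0 l i j)}.
  move=> Vx; have sE := dual_frame_strict Vx.
  exact: (strictN (strictM (volume_strict Vx)
    (strictD (strictM (sE j l) (sE i l0)) (strictN (strictM (sE i l) (sE j l0)))))).1.
have W l : wdiv V (fun i x => \sum_j C l0 l i j x * dN j x ord0 l)
    (\sum_i \sum_j dC l i j i * dN j p ord0 l) p.
  apply: (wdiv_skew (f := fun x => N x ord0 l) Vp _ (cC l) (sC l)).
    by move=> i j x; rewrite /C; ring.
  by move=> x Vx; exact: sN Vx ord0 l.
apply: wdiv_ext (wdiv_sum (index_enum 'I_n.+1) W); first by move=> i x Vx; rewrite sum_C.
(* The normal part of the derivative of the dual frame is a column of the shape operator, so the sum
   that survives is the trace of its square. *)
have aE i : Gi p *m hess Phi i p *m (N p)^T = col i (Defs.shape Phi (N p) p).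
  rewrite /Defs.shape colE -!mulmxA -colE; congr (_ *m _).
  rewrite -(second_form_sym oV N Phi2 Vp) -tr_row second_formE.
  by rewrite trmx_mul trmxK.
have <- : - - (volume p * N p ord0 l0 * \sum_i (dual_frame p *m (dnormal p)^T *m
    (Gi p *m hess Phi i p *m (N p)^T)) i ord0) =
    - (volume p * sqnorm_A Phi (N p) p * N p ord0 l0).
  rewrite opprK shapeE// -mulrA [RHS](_ : _ = volume p * (N p ord0 l0 * - sqnorm_A Phi (N p) p)).
    congr (_ * (_ * _)); rewrite /sqnorm_A /mxtrace -sumrN; apply: eq_bigr => i _.
    by rewrite aE mulNmx mxE colE mulmxA -colE mxE.
  by ring.
have K := divergence_contraction (E := dual_frame p) (D := dnormal p) (dE := dE^~ p)
  (dq := fun i => volume p * \tr (christoffel i p)) (q := volume p)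
  (Ga := christoffel^~ p) (a := fun i => Gi p *m hess Phi i p *m (N p)^T)
  (N := N p) l0 (fun=> erefl) (N_dnormal Vp) (fun=> erefl)
  (fun i j k => christoffel_sym i j k Vp) (trace_frame Vp).
rewrite -[X in _ = - X]K -sumrN exchange_big; apply: eq_bigr => i _ /=.
rewrite exchange_big -sumrN; apply: eq_bigr => j _; rewrite -sumrN; apply: eq_bigr => l _.
by rewrite [dnormal p _ _]mxE -mulNr.
Qed.

End NormalDivergence.

(** * Laplacian of the tilt function *)

Section TiltIdentity.
Variables (R : realType) (n : nat) (V : set 'rV[R]_n).
Hypothesis oV : open V.
Variables (Phi : 'rV[R]_n -> 'rV[R]_n.+1) (N : 'rV[R]_n -> 'rV[R]_n.+1).
Hypothesis Phi2 : forall l, Ck 2 V (fun y => Phi y ord0 l).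
Hypothesis fJ : forall x, V x -> row_free (Defs.jacobian Phi x).
Hypothesis NN1 : forall x, V x -> dotv (N x) (N x) = 1.
Hypothesis TN0 : forall x i, V x -> dotv (tangent Phi i x) (N x) = 0.
Variable dN : 'I_n -> 'rV[R]_n -> 'rV[R]_n.+1.
Hypothesis sN : forall x, V x -> mstrict N x (dN^~ x).
Hypothesis H0 : forall x, V x -> mean_curvature Phi (N x) x = 0.
Variables (k c : R) (l1 l2 : 'I_n.+1) (f : 'rV[R]_n -> R).
Hypothesis f2 : Ck 2 V f.
Hypothesis fE : forall x, V x ->
  f x ^+ 2 = 1 - N x ord0 l1 ^+ 2 - N x ord0 l2 ^+ 2 + k * (c - N x ord0 l1) ^+ 2.
Implicit Types (i j : 'I_n) (p x : 'rV[R]_n).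

Notation Gi x := (invmx (first_form Phi x)).

Definition gradient_norm2 x (u : 'I_n -> R) : R :=
  \sum_i u i * \sum_j Gi x i j * u j.

(** Minus half the derivative of the right-hand side of [fE] in the variable [N x ord0 l1]. *)
Let m x : R := N x ord0 l1 + k * (c - N x ord0 l1).

Let m_strict x : V x -> strict m x (fun i => (1 - k) * dN i x ord0 l1).
Proof.
move=> Vx; have s1 := sN Vx ord0 l1.
apply: strict_eq _ (strictD s1 (strictM (@strict_cst _ _ x k)
  (strictD (@strict_cst _ _ x c) (strictN s1)))) => i; ring.
Qed.

Lemma gradient_tilt x i : V x ->
  f x * partial i f x = - (m x * dN i x ord0 l1 + N x ord0 l2 * dN i x ord0 l2).
Proof.
move=> Vx; have sf := (Ck2_strict oV Vx f2).1.
have s1 := sN Vx ord0 l1; have s2 := sN Vx ord0 l2.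
have sc := strictD (@strict_cst _ _ x c) (strictN s1).
have S1 := strictM sf sf.
have S2 := strictD (strictD (strictD (@strict_cst _ _ x 1) (strictN (strictM s1 s1)))
  (strictN (strictM s2 s2))) (strictM (@strict_cst _ _ x k) (strictM sc sc)).
have S3 := strict_near _ S2.
have e := strict_unique S1 (S3 _ _) i.
suff /e : \forall y \near x, 1 - N y ord0 l1 * N y ord0 l1 - N y ord0 l2 * N y ord0 l2 +
    k * ((c - N y ord0 l1) * (c - N y ord0 l1)) = f y * f y by rewrite /m; lra.
near=> y; have Vy : V y by near: y; exact: open_nbhs_nbhs.
by rewrite -!expr2 fE.
Unshelve. all: by end_near. Qed.

(** One field, two weak divergences: since [f] is C^2, [Z] below has a classical divergence; and
    [gradient_tilt] expresses [f * Z] by gradients of the normal, to which the weak Jacobi equation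
    applies. *)
Lemma tilt_laplacian p : V p ->
  f p * laplace_beltrami Phi f p =
    sqnorm_A Phi (N p) p * (N p ord0 l1 * m p + N p ord0 l2 ^+ 2)
    - (1 - k) * gradient_norm2 p (fun i => dN i p ord0 l1)
    - gradient_norm2 p (fun i => dN i p ord0 l2)
    - gradient_norm2 p (fun i => partial i f p).
Proof.
move=> Vp.
pose Z i x := volume Phi x * \sum_j Gi x i j * partial j f x.
have sZ x i : V x -> exists d, strict (Z i) x d.
  move=> Vx; eexists; apply: strictM (volume_strict oV Phi2 fJ Vx) _.
  apply: strict_sum => j; apply: strictM ((Ck2_strict oV Vx f2).2 j).
  exact: (mstrict_inv (first_form_unit fJ Vx) (first_form_strict oV Phi2 Vx) i j).
have /choice[d sd] := fun i => sZ p i Vp.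
have ZE i x : V x -> f x * Z i x =
   - m x * (volume Phi x * grad_normal Phi dN l1 i x) -
   N x ord0 l2 * (volume Phi x * grad_normal Phi dN l2 i x).
  move=> Vx; rewrite /Z /grad_normal mulrCA mulr_sumr.
  rewrite [- m x * _]mulrCA [N x ord0 l2 * _]mulrCA -mulrBr; congr (_ * _).
  rewrite !mulr_sumr -sumrB; apply: eq_bigr => j _.
  by rewrite mulrCA gradient_tilt//; ring.
have W1 : wdiv V Z (\sum_i d i i) p.
  by apply: wdiv_strict sd => i x Vx; have [? []] := sZ x i Vx.
have sf x (Vx : V x) := (Ck2_strict oV Vx f2).1.
have {}W1 := wdivM Vp (fun x Vx => (sf x Vx).1) (sf p Vp) W1.
have wN := wdiv_grad_normal oV Phi2 fJ NN1 TN0 sN H0.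
have W2 := wdivM Vp (fun x Vx => (strictN (m_strict Vx)).1) (strictN (m_strict Vp)) (wN l1 p Vp).
have W3 := wdivM Vp (fun x Vx => (sN Vx ord0 l2).1) (sN Vp ord0 l2) (wN l2 p Vp).
have := wdiv_unique oV Vp W1 (wdiv_ext _ erefl (wdivB W2 W3)).
move=> /(_ (fun i x Vx => esym (ZE i x Vx))).
have v0 := volume_gt0 fJ Vp.
have -> : laplace_beltrami Phi f p = (volume Phi p)^-1 * \sum_i d i i.
  rewrite /laplace_beltrami; congr (_ * _); apply: eq_bigr => i _.
  exact: (strict_derivable i (sd i)).2.
have -> : \sum_i partial i f p * Z i p =
    volume Phi p * gradient_norm2 p (fun i => partial i f p).
  by rewrite mulr_sumr; apply: eq_bigr => i _; rewrite mulrCA.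
have gE l : \sum_i dN i p ord0 l * (volume Phi p * grad_normal Phi dN l i p) =
    volume Phi p * gradient_norm2 p (fun i => dN i p ord0 l).
  by rewrite mulr_sumr; apply: eq_bigr => i _; rewrite mulrCA.
rewrite gE.
have -> : \sum_i - ((1 - k) * dN i p ord0 l1) * (volume Phi p * grad_normal Phi dN l1 i p) =
    - (1 - k) * (volume Phi p * gradient_norm2 p (fun i => dN i p ord0 l1)).
  by rewrite -gE mulr_sumr; apply: eq_bigr => i _; ring.
move=> e; apply: (mulfI (lt0r_neq0 v0)).
rewrite mulrCA mulVKf ?gt_eqF//.
move/eqP: e; rewrite eq_sym -subr_eq => /eqP <-; ring.
Qed.

End TiltIdentity.

(** * The binary quadratic form and the constant *)

Section SymmetricMatrixBound.
Variable R : realType.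

Lemma quadratic_form_ge0 (p r s x y : R) :
  0 < p -> s ^+ 2 <= p * r -> 0 <= p * x ^+ 2 + 2 * s * x * y + r * y ^+ 2.
Proof.
move=> p0 spr; rewrite -(pmulr_rge0 _ p0).
have -> : p * (p * x ^+ 2 + 2 * s * x * y + r * y ^+ 2) =
  (p * x + s * y) ^+ 2 + (p * r - s ^+ 2) * y ^+ 2 by ring.
by apply: addr_ge0; rewrite ?sqr_ge0// mulr_ge0 ?sqr_ge0// subr_ge0.
Qed.

(** A sixth of the determinant computed in [fmm] below, with e = |cos theta|. *)
Definition capillary_delta (k e : R) : R := k ^+ 2 * (1 - e) ^+ 3 * (1 - k * e) / 6.

Lemma capillary_delta_gt0 (k e : R) : 0 < k -> k <= 1 -> 0 <= e -> e < 1 ->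
  0 < capillary_delta k e.
Proof.
move=> k0 k1 e0 e1; rewrite /capillary_delta divr_gt0// !mulr_gt0 ?exprn_gt0 ?subr_gt0//.
by rewrite (le_lt_trans (ler_wpM2r e0 k1))// mul1r.
Qed.

Lemma capillary_delta_le (k e : R) : 0 < k -> k <= 1 -> 0 <= e -> e < 1 ->
  6 * capillary_delta k e <= k * (k * (1 - e) ^+ 2).
Proof.
move=> k0 k1 e0 e1; rewrite /capillary_delta mulrC divfK ?pnatr_eq0//.
have a0 : 0 <= 1 - e by rewrite subr_ge0 ltW.
have -> : k ^+ 2 * (1 - e) ^+ 3 * (1 - k * e) =
  (k * (k * (1 - e) ^+ 2)) * ((1 - e) * (1 - k * e)) by ring.
have ke0 : 0 <= k * e by rewrite mulr_ge0// ltW.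
have ke1 : 0 <= 1 - k * e by rewrite subr_ge0 (le_trans (ler_wpM2r e0 k1))// mul1r ltW.
have K : (1 - e) * (1 - k * e) <= 1 by rewrite mulr_ile1// gerBl.
have k0' := ltW k0; by rewrite ler_piMr// mulr_ge0// mulr_ge0// sqr_ge0.
Qed.

(** Here [q1], [q2] stand for |A u_1|^2, |A u_2|^2 and [x], [y], [z] for the entries of A on u_1,
    u_2. Multiply the bound on [T] by [mu] and lower [q1], [q2] to their Bessel bounds: a
    nonnegative multiple of z^2 and a binary form in (x, y) remain. *)
Lemma capillary_scalar (k c a T q1 q2 x y z : R) (e := `|c|) :
  0 < k -> k <= 1 -> e < 1 -> `|a| <= 1 -> 0 <= T ->
  x ^+ 2 + z ^+ 2 <= q1 -> y ^+ 2 + z ^+ 2 <= q2 ->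
  2 * q1 + 2 * q2 - x ^+ 2 - 2 * z ^+ 2 - y ^+ 2 + k * (x + y) ^+ 2 <= T ->
  capillary_delta k e * T <=
    (1 + k * c * (c - a)) * T - q1 - (1 - k + k * c ^+ 2) * q2.
Proof.
move=> k0 k1 e1 a1 T0 h1 h2 hT.
have e0 : 0 <= e by exact: normr_ge0.
have c2 : c ^+ 2 = e ^+ 2 by rewrite /e real_normK ?num_real.
pose s := 1 - k + k * e ^+ 2.
pose d := capillary_delta k e.
have d0 : 0 < d by exact: capillary_delta_gt0.
have dl : 6 * d <= k * (k * (1 - e) ^+ 2) by exact: capillary_delta_le.
have k0' := ltW k0; have e1' := ltW e1.
(* The least value of [1 + k * c * (c - a)] over |a| <= 1. *)
pose mm := 1 - k * e * (1 - e).
have fmm : ((1 + k) * mm - 1) * ((1 + k) * mm - s) - (k * mm) ^+ 2 = 6 * d.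
  by rewrite /mm /s /d /capillary_delta; field.
have mm_le : mm <= 1 + k * c * (c - a).
  have ca : c * a <= e by rewrite (le_trans (ler_norm _))// normrM ler_piMr.
  have := ler_wpM2l (ltW k0) ca; rewrite /mm; move: c2; nra.
have k2 : k * (k * (1 - e) ^+ 2) <= k * (1 - e) ^+ 2.
  by rewrite ler_piMl// mulr_ge0 ?sqr_ge0// ltW.
have ke2 : 0 <= k * (1 - e) ^+ 2 by rewrite mulr_ge0 ?sqr_ge0// ltW.
pose mu := mm - d.
have mm1 : mm <= 1 by rewrite /mm gerBl !mulr_ge0 ?subr_ge0.
have s1 : s <= 1.
  rewrite /s addrAC -subr_ge0; have -> : 1 - (1 + k * e ^+ 2 - k) = k * (1 - e ^+ 2) by ring.
  by rewrite mulr_ge0 ?(ltW k0)// subr_ge0 expr_le1// ltW.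
have s0 : 0 <= s by rewrite /s addr_ge0 ?subr_ge0// mulr_ge0 ?sqr_ge0// ltW.
have musum : 0 <= 2 * mu - 1 - s.
  have -> : 2 * mu - 1 - s = k * (1 - e) ^+ 2 - 2 * d by rewrite /mu /mm /s; ring.
  by lra.
have p0 : 0 < (1 + k) * mu - 1.
  have -> : (1 + k) * mu - 1 =
      k * ((1 - e) ^+ 2 + e ^+ 2) + k * (1 - k) * (e * (1 - e)) - (1 + k) * d.
    by rewrite /mu /mm; ring.
  have h : 0 <= k * (1 - k) * (e * (1 - e)).
    by apply: mulr_ge0; apply: mulr_ge0; rewrite ?subr_ge0 ?(ltW k0)// ltW.
  have hd : (1 + k) * d <= 2 * d by rewrite ler_pM2r// -[2]/(1 + 1) lerD2l.
  have he : k * (1 - e) ^+ 2 + k * e ^+ 2 >= k / 2.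
    rewrite -mulrDr ler_wpM2l ?(ltW k0)//.
    have -> : (1 - e) ^+ 2 + e ^+ 2 = 2^-1 + 2 * (e - 2^-1) ^+ 2 by field.
    by rewrite lerDl mulr_ge0// sqr_ge0.
  have hk : k * (1 - e) ^+ 2 <= k.
    by rewrite ler_piMr ?(ltW k0)// expr_le1// ?subr_ge0 ?(ltW e1)// gerBl.
  rewrite mulrDr; lra.
have det : (k * mu) ^+ 2 <= ((1 + k) * mu - 1) * ((1 + k) * mu - s).
  rewrite -subr_ge0.
  (* Lowering [mm] by [d] costs the determinant at most 6d, because (1 + 2k) 2 mm <= 6; this is
     where the 6 in [capillary_delta] comes from. *)
  have -> : ((1 + k) * mu - 1) * ((1 + k) * mu - s) - (k * mu) ^+ 2 =
      (((1 + k) * mm - 1) * ((1 + k) * mm - s) - (k * mm) ^+ 2) - d * 6 +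
      d * (6 - (1 + 2 * k) * 2 * mm + (1 + k) * (1 + s) + (1 + 2 * k) * d).
    by rewrite /mu; ring.
  rewrite fmm mulrC subrr add0r mulr_ge0 ?(ltW d0)//.
  have k6 : 0 <= 1 + 2 * k by lra.
  have k3 : (1 + 2 * k) * 2 * mm <= (1 + 2 * k) * 2.
    by rewrite ler_piMr// mulr_ge0.
  have k4 : 0 <= (1 + k) * (1 + s) by apply: mulr_ge0; lra.
  have k5 : 0 <= (1 + 2 * k) * d by apply: mulr_ge0; lra.
  lra.
have Qf := quadratic_form_ge0 x y p0 det.
have mu0 : 0 <= mu by lra.
have h3 := ler_wpM2l mu0 hT.
have h4 := ler_wpM2r T0 mm_le.
rewrite c2 -/s -/d.
have r1 : 0 <= (2 * mu - 1) * (q1 - (x ^+ 2 + z ^+ 2)) by rewrite mulr_ge0 ?subr_ge0//; lra.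
have r2 : 0 <= (2 * mu - s) * (q2 - (y ^+ 2 + z ^+ 2)) by rewrite mulr_ge0 ?subr_ge0//; lra.
have r3 : 0 <= (2 * mu - 1 - s) * z ^+ 2 by rewrite mulr_ge0 ?sqr_ge0.
have dmu : mu * T = mm * T - d * T by rewrite /mu mulrBl.
move: r1 r2 r3 h3 h4 dmu; lra.
Qed.

End SymmetricMatrixBound.

(** * Trace-free symmetric matrices in an adapted frame *)

Section FrameBound.
Variables (R : realType) (n : nat).
Implicit Types (u v w : 'rV[R]_n).

Lemma dotvC u v : dotv u v = dotv v u.
Proof. by apply: eq_bigr => j _; rewrite mulrC. Qed.

Lemma dotvDl u v w : dotv (u + v) w = dotv u w + dotv v w.
Proof. by rewrite -big_split; apply: eq_bigr => j _; rewrite mxE mulrDl. Qed.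

Lemma dotvZl a u v : dotv (a *: u) v = a * dotv u v.
Proof. by rewrite mulr_sumr; apply: eq_bigr => j _; rewrite mxE mulrA. Qed.

Lemma dotvDr u v w : dotv w (u + v) = dotv w u + dotv w v.
Proof. by rewrite !(dotvC w) dotvDl. Qed.

Lemma dotvZr a u v : dotv v (a *: u) = a * dotv v u.
Proof. by rewrite !(dotvC v) dotvZl. Qed.

Lemma dotv_ge0 u : 0 <= dotv u u.
Proof. by apply: sumr_ge0 => j _; rewrite -expr2 sqr_ge0. Qed.

Lemma dotv_mx u v : u *m v^T = (dotv u v)%:M.
Proof. by rewrite [LHS]mx11_scalar -dotvE. Qed.

Lemma trace_rank1 u v : \tr (u^T *m v) = dotv u v.
Proof. by rewrite mxtrace_mulC dotv_mx mxtrace_scalar mulr1n dotvC. Qed.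

Lemma dotv_mulr (A : 'M[R]_n) u v : A^T = A -> dotv (u *m A) v = dotv u (v *m A).
Proof. by move=> sA; rewrite !dotvE trmx_mul sA mulmxA. Qed.

(** The squared Frobenius norm of P A P + t P: a Cauchy-Schwarz inequality that does not divide by
    the rank of [P], which may be 0. *)
Lemma compression_bound (A P : 'M[R]_n) t : A^T = A -> P^T = P -> P *m P = P ->
  0 <= \tr (P *m A *m (P *m A)) + 2 * t * \tr (P *m A) + t ^+ 2 * \tr P.
Proof.
move=> sA PT PP; have := mxtrace_gram_ge0 (P *m A *m P + t *: P).
have -> : (P *m A *m P + t *: P)^T = P *m (A *m P) + t *: P.
  by rewrite [LHS]linearD /= [in LHS]linearZ /= !trmx_mul PT sA.
have PAPP : P *m A *m P *m P = P *m A *m P by rewrite -(mulmxA _ P P) PP.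
have -> : (P *m A *m P + t *: P) *m (P *m (A *m P) + t *: P) =
    P *m A *m P *m A *m P + t *: (P *m A *m P) + (t *: (P *m A *m P) + t ^+ 2 *: P).
  rewrite mulmxDl !mulmxDr -!scalemxAl -!scalemxAr !scalerA -expr2 !mulmxA.
  by rewrite !PAPP PP.
rewrite !mxtraceD !mxtraceZ.
have -> : \tr (P *m A *m P *m A *m P) = \tr (P *m A *m (P *m A)).
  by rewrite mxtrace_mulC !mulmxA PP.
have -> : \tr (P *m A *m P) = \tr (P *m A) by rewrite mxtrace_mulC mulmxA PP.
by congr (_ <= _); ring.
Qed.

Variables (A : 'M[R]_n) (N u1 u2 : 'rV[R]_n) (k : R).
Hypotheses (sA : A^T = A) (NA : N *m A = 0) (trA : \tr A = 0).
Hypotheses (NN : dotv N N = 1) (u11 : dotv u1 u1 = 1) (u22 : dotv u2 u2 = 1).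
Hypotheses (u12 : dotv u1 u2 = 0) (Nu1 : dotv N u1 = 0) (Nu2 : dotv N u2 = 0).
Hypothesis hk : n = 3%N \/ (n%:R - 3) * k = 1.

Let x := dotv (u1 *m A) u1.
Let y := dotv (u2 *m A) u2.
Let z := dotv (u1 *m A) u2.
Let q1 := dotv (u1 *m A) (u1 *m A).
Let q2 := dotv (u2 *m A) (u2 *m A).

(** Expand the squared length of what remains of [u1 *m A] and [u2 *m A] after projection to the
    span of [u1], [u2]. *)
Lemma frame_bessel : x ^+ 2 + z ^+ 2 <= q1 /\ y ^+ 2 + z ^+ 2 <= q2.
Proof.
have z' : dotv (u2 *m A) u1 = z by rewrite dotv_mulr// dotvC.
have e1 : dotv u1 (u1 *m A) = x by rewrite dotvC.
have e2 : dotv u2 (u1 *m A) = z by rewrite dotvC.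
have e3 : dotv u1 (u2 *m A) = z by rewrite dotvC.
have e4 : dotv u2 (u2 *m A) = y by rewrite dotvC.
have u21 : dotv u2 u1 = 0 by rewrite dotvC.
have := dotv_ge0 (u1 *m A + (- x) *: u1 + (- z) *: u2).
have := dotv_ge0 (u2 *m A + (- z) *: u1 + (- y) *: u2).
rewrite !(dotvDl, dotvDr, dotvZl, dotvZr) -/x -/y -/z -/q1 -/q2.
by rewrite z' u11 u22 u12 u21 e1 e2 e3 e4 => h1 h2; split; lra.
Qed.

(** Projection to the complement of [N], [u1], [u2]. In this section [n] is the ambient dimension,
    so its rank is n - 3. *)
Let P : 'M[R]_n := 1%:M - N^T *m N - u1^T *m u1 - u2^T *m u2.

Let PT : P^T = P.
Proof. by rewrite /P !raddfB /= trmx1 !trmx_mul !trmxK. Qed.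

Let PP : P *m P = P.
Proof.
have PN : P *m N^T = 0.
  rewrite !mulmxBl mul1mx -!mulmxA !dotv_mx !mul_mx_scalar NN (dotvC u1) (dotvC u2) Nu1 Nu2.
  by rewrite !scale0r scale1r !subr0 subrr.
have P1 : P *m u1^T = 0.
  rewrite !mulmxBl mul1mx -!mulmxA !dotv_mx !mul_mx_scalar u11 Nu1 (dotvC u2) u12.
  by rewrite !scale0r scale1r !subr0 subrr.
have P2 : P *m u2^T = 0.
  rewrite !mulmxBl mul1mx -!mulmxA !dotv_mx !mul_mx_scalar u22 Nu2 u12.
  by rewrite !scale0r scale1r !subr0 subrr.
by rewrite {2}/P !mulmxBr mulmx1 !mulmxA PN P1 P2 !mul0mx !subr0.
Qed.

Let trP : \tr P = n%:R - 3.
Proof.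
rewrite /P !raddfB /= mxtrace1 !trace_rank1 NN u11 u22; ring.
Qed.

Let PA : P *m A = A - u1^T *m (u1 *m A) - u2^T *m (u2 *m A).
Proof. by rewrite /P !mulmxBl mul1mx -!mulmxA NA mulmx0 subr0. Qed.

Lemma frame_bound : 2 * q1 + 2 * q2 - x ^+ 2 - 2 * z ^+ 2 - y ^+ 2 + k * (x + y) ^+ 2 <=
  \tr (A *m A).
Proof.
set K := P *m A.
have trK : \tr K = - (x + y).
  rewrite /K PA !raddfB /= trA !trace_rank1 !(dotvC _ (_ *m A)) -/x -/y; ring.
have trKK : \tr (K *m K) = \tr (A *m A) - 2 * q1 - 2 * q2 + x ^+ 2 + y ^+ 2 + 2 * z ^+ 2.
  have z' : dotv (u2 *m A) u1 = z by rewrite dotv_mulr// dotvC.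
  have Au v : A *m v^T = (v *m A)^T by rewrite trmx_mul sA.
  have T1 v w : \tr (v^T *m w *m A) = dotv (v *m A) w.
    by rewrite -mulmxA trace_rank1 -dotv_mulr.
  have T2 v w : \tr (A *m (v^T *m w)) = dotv (v *m A) w.
    by rewrite mulmxA Au trace_rank1.
  have T3 v w v' w' : \tr (v^T *m w *m (v'^T *m w')) = dotv w v' * dotv v w'.
    rewrite -mulmxA (mulmxA w) dotv_mx mul_scalar_mx -scalemxAr mxtraceZ trace_rank1.
    by [].
  rewrite /K PA !mulmxBl !mulmxBr !raddfB /= !T1 !T2 !T3 -/q1 -/q2.
  rewrite -/x -/y -/z ?z' !(dotvC _ (_ *m A)) -/x -/y -/z ?z'; ring.
have main t : 0 <= \tr (K *m K) + 2 * t * \tr K + t ^+ 2 * (n%:R - 3).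
  by rewrite -trP; exact: compression_bound.
case: hk => [n3|nk]; last first.
  (* The minimizer of the quadratic polynomial in [t], since [k] is the inverse of n - 3. *)
  have := main (- k * \tr K); rewrite trK trKK.
  have -> : (- k * - (x + y)) ^+ 2 * (n%:R - 3) = k * (x + y) ^+ 2 * ((n%:R - 3) * k) by ring.
  rewrite nk; nra.
(* In ambient dimension 3 the complement is trivial, which forces x + y = 0 and removes the term
   with [k]. *)
have P0 : P = 0 by apply: mxtrace_gram_eq0; rewrite PT PP trP n3 subrr.
have : \tr K = 0 by rewrite /K P0 mul0mx mxtrace0.
have : \tr (K *m K) = 0 by rewrite /K P0 !mul0mx mxtrace0.
rewrite trK trKK => h1 /eqP; rewrite oppr_eq0 => /eqP ->.
by rewrite expr0n /= mulr0; lra.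
Qed.

End FrameBound.

(** * The matrix inequality for the tilt function *)

Section CapillaryAlgebra.
Variables (R : realType) (n : nat).
Hypothesis hn : (2 <= n)%N.
Variables (A : 'M[R]_n.+1) (N : 'rV[R]_n.+1) (k c : R).
Hypotheses (sA : A^T = A) (NA : N *m A = 0) (trA : \tr A = 0) (NN : dotv N N = 1).
Hypotheses (hk : n.+1 = 3%N \/ (n.+1%:R - 3) * k = 1) (k0 : 0 < k) (k1 : k <= 1).
Hypothesis (c1 : `|c| < 1).

Let a := N ord0 ord0.
Let b := N ord0 ord_max.
Let E := 1 - a ^+ 2 - b ^+ 2.
Let G := E + k * (c - a) ^+ 2.
Hypothesis G0 : 0 < G.

Let e l : 'rV[R]_n.+1 := delta_mx ord0 l.
Let e0 := e ord0.
Let e1 := e ord_max.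

Let dot_e u l : dotv (e l) u = u ord0 l.
Proof.
rewrite /dotv (bigD1 l)//= mxE !eqxx mul1r big1 ?addr0// => j /negbTE jl.
by rewrite mxE jl andbF mul0r.
Qed.

Let max_neq0 : (ord_max == ord0 :> 'I_n.+1) = false.
Proof. by apply/negbTE; rewrite -val_eqE /= -lt0n (leq_trans _ hn). Qed.

Let component_le l : l != ord0 -> l != ord_max -> N ord0 l ^+ 2 <= E.
Proof.
move=> l0 lm; have := NN; rewrite /dotv (bigD1 ord0)//= (bigD1 ord_max)/= ?max_neq0//.
rewrite (bigD1 l) ?l0 ?lm//= -/a -/b -!expr2 => h.
have : 0 <= \sum_(i < n.+1 | (i != ord0) && (i != ord_max) && (i != l)) N ord0 i * N ord0 i.
  by apply: sumr_ge0 => i _; rewrite -expr2 sqr_ge0.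
by rewrite /E; lra.
Qed.

(** A coordinate besides the first and the last; it yields E >= 0 and a substitute direction when E
    = 0. *)
Let l1 : 'I_n.+1 := inord 1.

Let l1_neq : (l1 == ord0) = false /\ (l1 == ord_max) = false.
Proof.
have v : l1 = 1%N :> nat by rewrite inordK// ltnS ltnW.
by split; apply/negbTE; rewrite -val_eqE /= v// neq_ltn hn.
Qed.

Let E_ge0 : 0 <= E.
Proof.
have [h0 hm] := l1_neq; apply: le_trans (sqr_ge0 _) (component_le (l := l1) _ _).
  by rewrite h0.
by rewrite hm.
Qed.

Let Z := (c - a) ^+ 2 + (1 - c ^+ 2) * E.

Let c2 : 0 < 1 - c ^+ 2.
Proof. by rewrite subr_gt0 -real_normK ?num_real// expr_lt1. Qed.

Let Z0 : 0 < Z.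
Proof.
rewrite /Z; have [E0|E0] := ltP 0 E.
  by apply: ltr_wpDl; [exact: sqr_ge0|exact: mulr_gt0].
(* In this case 0 < G = k (c - a)^2, which keeps [Z] positive. *)
have E00 : E = 0 by apply/eqP; rewrite eq_le E0 E_ge0.
move: G0; rewrite /G E00 mulr0 addr0 add0r pmulr_rgt0//.
Qed.

Let q00 := dotv (e0 *m A) (e0 *m A).
Let q01 := dotv (e0 *m A) (e1 *m A).
Let q11 := dotv (e1 *m A) (e1 *m A).

Let comb (r s t : R) : 'rV[R]_n.+1 := r *: e0 + s *: e1 + t *: N.

Let dot_comb r s t r' s' t' : dotv (comb r s t) (comb r' s' t') =
  r * r' + s * s' + t * t' + a * (r * t' + t * r') + b * (s * t' + t * s').
Proof.
rewrite /comb !(dotvDl, dotvDr, dotvZl, dotvZr) NN.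
rewrite /e0 /e1 !(dotvC N) !dot_e -/a -/b !mxE !eqxx /= eq_sym max_neq0 mulr0n; ring.
Qed.

Let dot_N_comb r s t : dotv N (comb r s t) = a * r + b * s + t.
Proof.
rewrite /comb !(dotvDr, dotvZr) NN /e0 /e1 !(dotvC N) !dot_e -/a -/b; ring.
Qed.

Let comb_mul r s t : comb r s t *m A = r *: (e0 *m A) + s *: (e1 *m A).
Proof. by rewrite !mulmxDl -!scalemxAl NA scaler0 addr0. Qed.

Let norm_comb r s t : dotv (comb r s t *m A) (comb r s t *m A) =
  r ^+ 2 * q00 + 2 * (r * s) * q01 + s ^+ 2 * q11.
Proof.
rewrite comb_mul !(dotvDl, dotvDr, dotvZl, dotvZr) (dotvC (e1 *m A)) -/q00 -/q01 -/q11; ring.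
Qed.

(* Orthogonal tangential vectors of square lengths Z and E Z that diagonalize
   the quadratic form on the left-hand side of [quadratic_form_diag]. *)
Let w1 := comb (b * c) (1 - a * c) (- b).
Let w2 := comb (1 - a * c - b ^+ 2) (- (b * (c - a))) (c * (a ^+ 2 + b ^+ 2) - a).

Let w11 : dotv w1 w1 = Z.
Proof. by rewrite dot_comb /Z /E; ring. Qed.

Let w22 : dotv w2 w2 = E * Z.
Proof. by rewrite dot_comb /Z /E; ring. Qed.

Let w12 : dotv w1 w2 = 0.
Proof. by rewrite dot_comb; ring. Qed.

Let Nw1 : dotv N w1 = 0.
Proof. by rewrite dot_N_comb; ring. Qed.

Let Nw2 : dotv N w2 = 0.
Proof. by rewrite dot_N_comb; ring. Qed.

Let m := a + k * (c - a).

Lemma quadratic_form_diag :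
  (1 - k) * q00 + q11 + (m ^+ 2 * q00 + 2 * (m * b) * q01 + b ^+ 2 * q11) / G =
  dotv (w1 *m A) (w1 *m A) / Z + (1 - k + k * c ^+ 2) * dotv (w2 *m A) (w2 *m A) / (G * Z).
Proof.
rewrite !norm_comb.
have -> : (1 - k) * q00 + q11 = ((1 - k) * q00 + q11) * G * Z / (G * Z).
  by field; rewrite !gt_eqF.
have -> x : x / G = x * Z / (G * Z) by field; rewrite !gt_eqF.
have -> x : x / Z = x * G / (G * Z) by field; rewrite !gt_eqF.
rewrite -!mulrDl; congr (_ / _).
by rewrite /G /Z /E /m; ring.
Qed.

Lemma capillary_matrix_bound :
  capillary_delta k `|c| * \tr (A *m A) <= (1 + k * c * (c - a)) * \tr (A *m A)
    - ((1 - k) * q00 + q11 + (m ^+ 2 * q00 + 2 * (m * b) * q01 + b ^+ 2 * q11) / G).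
Proof.
have s0 : 0 <= 1 - k + k * c ^+ 2.
  by rewrite addr_ge0 ?subr_ge0// mulr_ge0 ?sqr_ge0// ltW.
pose u1 := (Num.sqrt Z)^-1 *: w1.
have sZ : (Num.sqrt Z)^-1 * ((Num.sqrt Z)^-1 * Z) = 1.
  by rewrite -{3}[Z]sqr_sqrtr ?(ltW Z0)// expr2 mulKf ?mulVf// gt_eqF// sqrtr_gt0.
have u11 : dotv u1 u1 = 1 by rewrite dotvZl dotvZr w11.
have Nu1 : dotv N u1 = 0 by rewrite dotvZr Nw1 mulr0.
have Q1 : dotv (u1 *m A) (u1 *m A) = dotv (w1 *m A) (w1 *m A) / Z.
  rewrite -scalemxAl dotvZl dotvZr mulrA mulrC; congr (_ * _).
  by apply: (mulIf (lt0r_neq0 Z0)); rewrite mulVf ?gt_eqF// -mulrA sZ.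
(* An inequality is enough for [u2]: |A w2|^2 carries the weight 1/(G Z), normalization of [w2]
   gives 1/(E Z), and E <= G. *)
suff [u2 [u22 u12 Nu2 Q2]] : exists u2, [/\ dotv u2 u2 = 1, dotv u1 u2 = 0, dotv N u2 = 0 &
    dotv (w2 *m A) (w2 *m A) / (G * Z) <= dotv (u2 *m A) (u2 *m A)].
  have [B1 B2] := frame_bessel sA u11 u22 u12.
  have F := frame_bound sA NA trA NN u11 u22 u12 Nu1 Nu2 hk.
  have T0 : 0 <= \tr (A *m A) by rewrite -{2}sA mxtrace_gram_ge0.
  have a1 : `|a| <= 1.
    rewrite -(@ler_pXn2r _ 2)// ?nnegrE// real_normK ?num_real// expr1n.
    by have := E_ge0; have := sqr_ge0 b; rewrite /E; lra.
  have := capillary_scalar k0 k1 c1 a1 T0 B1 B2 F.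
  rewrite quadratic_form_diag -Q1 -mulrA => /le_trans; apply.
  by have := ler_wpM2l s0 Q2; lra.
have [E0|E0] := ltP 0 E.
  have EZ0 : 0 < E * Z by rewrite mulr_gt0.
  exists ((Num.sqrt (E * Z))^-1 *: w2).
  have sEZ : (Num.sqrt (E * Z))^-1 * ((Num.sqrt (E * Z))^-1 * (E * Z)) = 1.
    by rewrite -{3}[E * Z]sqr_sqrtr ?(ltW EZ0)// expr2 mulKf ?mulVf// gt_eqF// sqrtr_gt0.
  split; rewrite ?dotvZl ?dotvZr ?w22 ?w12 ?Nw2 ?mulr0//.
  rewrite -scalemxAl dotvZl dotvZr mulrA.
  have -> : (Num.sqrt (E * Z))^-1 * (Num.sqrt (E * Z))^-1 = (E * Z)^-1.
    by apply: (mulIf (lt0r_neq0 EZ0)); rewrite mulVf ?gt_eqF// -mulrA sEZ.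
  rewrite mulrC ler_wpM2r ?dotv_ge0// lef_pV2 ?posrE ?mulr_gt0// ler_pM2r//.
  by rewrite lerDl mulr_ge0 ?sqr_ge0// ltW.
(* Now [N] lies in the span of the first and last basis vectors and [w2] vanishes, so any unit
   vector orthogonal to [N] and [u1] will do. *)
have E00 : E = 0 by apply/eqP; rewrite eq_le E0 E_ge0.
have [h0 hm] := l1_neq.
have Nl : N ord0 l1 = 0.
  apply/eqP; rewrite -sqrf_eq0 eq_le sqr_ge0 andbT -E00.
  by apply: component_le; rewrite ?h0 ?hm.
have w20 : w2 = 0.
  by apply: mxtrace_gram_eq0; rewrite dotv_mx mxtrace_scalar w22 E00 mul0r.
exists (e l1); split.
- by rewrite dot_e mxE !eqxx.
- by rewrite dotvC dot_e !mxE Nl h0 hm /= !mulr0 !addr0 mulr0.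
- by rewrite dotvC dot_e.
- by rewrite w20 mul0mx -[X in dotv X _](scale0r 0) dotvZl !mul0r dotv_ge0.
Qed.

End CapillaryAlgebra.

(** * The inequality at interior points *)

Section InteriorBound.
Variables (R : realType) (n : nat) (V : set 'rV[R]_n).
Hypothesis hn : (2 <= n)%N.
Hypothesis oV : open V.
Variables (Phi : 'rV[R]_n -> 'rV[R]_n.+1) (N : 'rV[R]_n -> 'rV[R]_n.+1).
Hypothesis Phi2 : forall l, Ck 2 V (fun y => Phi y ord0 l).
Hypothesis fJ : forall x, V x -> row_free (Defs.jacobian Phi x).
Hypothesis cN : forall x l, V x -> {for x, continuous (fun y => N y ord0 l)}.
Hypothesis NN1 : forall x, V x -> dotv (N x) (N x) = 1.
Hypothesis TN0 : forall x i, V x -> dotv (tangent Phi i x) (N x) = 0.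
Hypothesis H0 : forall x, V x -> mean_curvature Phi (N x) x = 0.
Variables (k c : R) (f : 'rV[R]_n -> R).
Hypotheses (hk : n.+1 = 3%N \/ (n.+1%:R - 3) * k = 1) (k0 : 0 < k) (k1 : k <= 1).
Hypothesis c1 : `|c| < 1.
Hypothesis f2 : Ck 2 V f.
Hypothesis fE : forall x, V x ->
  f x ^+ 2 = 1 - N x ord0 ord0 ^+ 2 - N x ord0 ord_max ^+ 2 + k * (c - N x ord0 ord0) ^+ 2.

Notation Gi x := (invmx (first_form Phi x)).
Notation h x := (second_form Phi (N x) x).

Lemma normal_strict_field :
  exists dN : 'I_n -> 'rV[R]_n -> 'rV[R]_n.+1, forall x, V x -> mstrict N x (dN^~ x).
Proof.
have H x : exists d : 'I_n -> 'rV[R]_n.+1, V x -> mstrict N x d.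
  have [Vx|nVx] := pselect (V x); last by exists (fun=> 0).
  by have [d Hd] := normal_strict oV Phi2 fJ cN NN1 TN0 Vx; exists d.
have /choice[d Hd] := H.
by exists (fun i x => d x i).
Qed.

(** The shape operator as a symmetric matrix on R^(n+1) that kills the normal, so that frames can be
    orthonormal for the standard inner product instead of the metric. *)
Definition ambient_shape x : 'M[R]_n.+1 := (dual_frame Phi x)^T *m h x *m dual_frame Phi x.

Let dual_frame_gram x : V x -> dual_frame Phi x *m (dual_frame Phi x)^T = Gi x.
Proof.
move=> Vx; rewrite /dual_frame trmx_mul {2}first_formE gram_invmx_sym -first_formE.
by rewrite mulmxA -(mulmxA (Gi x)) -first_formE mulVmx ?mul1mx// (first_form_unit fJ).
Qed.

Lemma ambient_shape_sym x : V x -> (ambient_shape x)^T = ambient_shape x.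
Proof.
move=> Vx; have := second_form_sym oV N Phi2 Vx; rewrite /ambient_shape.
by move: (dual_frame Phi x) (h x) => D B sB; rewrite !trmx_mul trmxK sB mulmxA.
Qed.

Lemma normal_ambient_shape x : V x -> N x *m ambient_shape x = 0.
Proof.
move=> Vx; rewrite /ambient_shape !mulmxA; have -> : N x *m (dual_frame Phi x)^T = 0.
  rewrite -[LHS]trmxK trmx_mul trmxK /dual_frame -mulmxA.
  by rewrite (tangent_normal0 TN0 Vx) mulmx0 trmx0.
by rewrite !mul0mx.
Qed.

Lemma trace_ambient_shape x : V x -> \tr (ambient_shape x) = 0.
Proof.
move=> Vx; rewrite /ambient_shape mxtrace_mulC mulmxA dual_frame_gram//.
exact: H0.
Qed.

Lemma ambient_shape_square x : V x -> ambient_shape x *m ambient_shape x =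
  (dual_frame Phi x)^T *m h x *m Gi x *m h x *m dual_frame Phi x.
Proof.
move=> Vx; have := dual_frame_gram Vx; rewrite /ambient_shape.
move: (dual_frame Phi x) (h x) (Gi x) => D B C <-.
by rewrite !mulmxA.
Qed.

Lemma sqnorm_ambient_shape x : V x ->
  \tr (ambient_shape x *m ambient_shape x) = sqnorm_A Phi (N x) x.
Proof.
move=> Vx; rewrite ambient_shape_square// /sqnorm_A /Defs.shape.
have := dual_frame_gram Vx; move: (dual_frame Phi x) (h x) (Gi x) => D B C <-.
by rewrite mxtrace_mulC !mulmxA.
Qed.

(** By the Weingarten equation the gradient of the component of [N] along [v] is minus the shape
    operator applied to [v]. *)
Lemma gradient_norm2_ambient dN x (u : 'I_n -> R) (v : 'rV[R]_n.+1) :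
  (forall x, V x -> mstrict N x (dN^~ x)) -> V x ->
  (forall i, u i = (dnormal dN x *m v^T) i ord0) ->
  gradient_norm2 Phi x u = dotv (v *m ambient_shape x) (v *m ambient_shape x).
Proof.
move=> sN Vx uE; rewrite dotvE trmx_mul ambient_shape_sym// mulmxA -(mulmxA v).
rewrite ambient_shape_square//.
pose U := dnormal dN x *m v^T.
have UE : U = - (h x *m dual_frame Phi x *m v^T).
  by rewrite /U (weingarten oV Phi2 fJ NN1 TN0 sN Vx) mulNmx.
have -> : v *m ((dual_frame Phi x)^T *m h x *m Gi x *m h x *m dual_frame Phi x) *m v^T =
    U^T *m Gi x *m U.
  rewrite UE; have := second_form_sym oV N Phi2 Vx.
  move: (dual_frame Phi x) (h x) (Gi x) => D B C sB.
  by rewrite [(- _)^T]linearN /= !trmx_mul trmxK sB !(mulNmx, mulmxN) opprK !mulmxA.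
rewrite -mulmxA mxE; apply: eq_bigr => i _.
rewrite [X in _ = X * _]mxE [X in _ = _ * X]mxE -uE; congr (_ * _).
by apply: eq_bigr => j _; rewrite -uE.
Qed.

Lemma interior_bound p : V p -> 0 < f p ->
  capillary_delta k `|c| * sqnorm_A Phi (N p) p <=
    f p * (laplace_beltrami Phi f p + sqnorm_A Phi (N p) p * f p).
Proof.
move=> Vp fp0; have [dN sN] := normal_strict_field.
pose a := N p ord0 ord0; pose b := N p ord0 ord_max; pose m := a + k * (c - a).
pose e l : 'rV[R]_n.+1 := delta_mx ord0 l.
have dE l i : dN i p ord0 l = (dnormal dN p *m (e l)^T) i ord0.
  rewrite mxE (bigD1 l)//= !mxE !eqxx mulr1 big1 ?addr0// => j /negbTE jl.
  by rewrite !mxE jl andbF mulr0.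
have Q l := gradient_norm2_ambient sN Vp (dE l).
have G0 : 0 < f p ^+ 2 by rewrite exprn_gt0.
(* The factor f^2 replaces grad f by f grad f, a linear combination of gradients of two components
   of the normal. *)
have Qf : f p ^+ 2 * gradient_norm2 Phi p (fun i => partial i f p) =
    gradient_norm2 Phi p (fun i => m * dN i p ord0 ord0 + b * dN i p ord0 ord_max).
  rewrite /gradient_norm2 mulr_sumr; apply: eq_bigr => i _.
  rewrite !mulr_sumr; apply: eq_bigr => j _.
  have gt i' := gradient_tilt oV sN f2 fE i' Vp.
  have -> : f p ^+ 2 * (partial i f p * (Gi p i j * partial j f p)) =
    (f p * partial i f p) * (Gi p i j * (f p * partial j f p)) by ring.
  by rewrite !gt -/a -/b -/m; ring.
have Qw := @gradient_norm2_ambient dN p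
  (fun i => m * dN i p ord0 ord0 + b * dN i p ord0 ord_max) (m *: e ord0 + b *: e ord_max) sN Vp.
have {}Qw := Qw _.
have T := tilt_laplacian oV Phi2 fJ NN1 TN0 sN H0 f2 fE Vp.
have := capillary_matrix_bound hn (ambient_shape_sym Vp) (normal_ambient_shape Vp)
  (trace_ambient_shape Vp) (NN1 Vp) hk k0 k1 c1.
rewrite -fE// => /(_ G0); rewrite sqnorm_ambient_shape// => B.
apply: le_trans B _.
have -> : f p * (laplace_beltrami Phi f p + sqnorm_A Phi (N p) p * f p) =
  f p * laplace_beltrami Phi f p + sqnorm_A Phi (N p) p * f p ^+ 2 by ring.
rewrite T !Q.
have -> : gradient_norm2 Phi p (fun i => partial i f p) =
   (f p ^+ 2 * gradient_norm2 Phi p (fun i => partial i f p)) / f p ^+ 2.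
  by rewrite mulrC mulKf// gt_eqF.
rewrite Qf Qw.
  rewrite !mulmxDl -!scalemxAl !(dotvDl, dotvDr, dotvZl, dotvZr).
  rewrite (dotvC (e ord_max *m _) (e ord0 *m _)) -/a -/b -/m -/(e ord0) -/(e ord_max).
  rewrite [X in _ <= _ + _ * X](fE Vp) -/a -/b.
  move: (dotv _ _) (dotv _ _) (dotv _ _) => q00 q01 q11.
  by rewrite le_eqVlt; apply/orP; left; apply/eqP; rewrite /m; ring.
move=> i; rewrite !dE [(_ + _)^T]linearD /= !linearZ /= mulmxDr -!scalemxAr.
by rewrite [RHS]mxE; congr (_ + _); rewrite [RHS]mxE.
Qed.

End InteriorBound.

(** * Passage to the boundary *)

Section BoundaryContinuity.
Variable R : realType.

Lemma Ck_sub n k (V V' : set 'rV[R]_n) f : V' `<=` V -> Ck k V f -> Ck k V' f.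
Proof.
move=> sV; elim: k f => [|k IH] f [cf H]; split=> [x /sV/cf//|] //= i.
by have [d c] := H i; split => [x /sV/d//|]; exact: IH.
Qed.

Definition mcvg T (F : set_system T) a b (A : T -> 'M[R]_(a, b)) (L : 'M[R]_(a, b)) :=
  forall i j, A t i j @[t --> F] --> L i j.

Lemma mcvgM T (F : set_system T) (FF : Filter F) a b c (A : T -> 'M[R]_(a, b))
    (B : T -> 'M[R]_(b, c)) L K :
  mcvg F A L -> mcvg F B K -> mcvg F (fun t => A t *m B t) (L *m K).
Proof.
move=> hA hB i j; rewrite mxE; under eq_cvg do rewrite mxE.
by apply: cvg_sumr => k; exact: cvgM.
Qed.

Lemma cvg_mxtrace T (F : set_system T) (FF : Filter F) a (A : T -> 'M[R]_a) L :
  mcvg F A L -> \tr (A t) @[t --> F] --> \tr L.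
Proof. by move=> hA; apply: cvg_sumr => k; exact: hA. Qed.

Variables (n : nat) (V : set 'rV[R]_n) (Phi : 'rV[R]_n -> 'rV[R]_n.+1).
Hypothesis oV : open V.
Hypothesis Phi2 : forall l, Ck 2 V (fun y => Phi y ord0 l).
Hypothesis fJ : forall x, V x -> row_free (Defs.jacobian Phi x).

(** The normals form a separate family [N t] because the normal lives on the hypersurface and is
    continuous only from within the half-space. *)
Lemma sqnorm_A_cvg T (F : set_system T) (FF : Filter F) (y : T -> 'rV[R]_n) x
    (N : T -> 'rV[R]_n.+1) N0 : V x -> y @ F --> x -> mcvg F N N0 ->
  sqnorm_A Phi (N t) (y t) @[t --> F] --> sqnorm_A Phi N0 x.
Proof.
move=> Vx yx hN.
suff hS : mcvg F (fun t => Defs.shape Phi (N t) (y t)) (Defs.shape Phi N0 x).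
  by apply: cvg_mxtrace; exact: mcvgM.
apply: mcvgM => i j.
  have [cG _] := mstrict_inv (first_form_unit fJ Vx) (first_form_strict oV Phi2 Vx) i j.
  exact: cvg_comp yx cG.
have -> : second_form Phi N0 x i j = \sum_l N0 ord0 l * hess Phi i x j l.
  exact: (second_form_entry Phi (fun=> N0)).
have -> : (fun t => second_form Phi (N t) (y t) i j) =
    (fun t => \sum_l N t ord0 l * hess Phi i (y t) j l).
  by apply/funext => t; exact: (second_form_entry Phi (fun=> N t)).
apply: cvg_sumr => l.
apply: cvgM; first exact: hN.
have [_ /(_ j) [_ [_ /(_ i) [_ [cd _]]]]] := Phi2 l.
rewrite [hess _ _ _ _ _]mxE.
have -> : (fun t => hess Phi i (y t) j l) =
    (fun t => partial i (partial j (fun z => Phi z ord0 l)) (y t)).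
  by apply/funext => t; rewrite mxE.
exact: cvg_comp yx (cd _ Vx).
Qed.

Lemma laplace_beltrami_continuous f x : Ck 2 V f -> V x ->
  {for x, continuous (laplace_beltrami Phi f)}.
Proof.
move=> f2 Vx.
pose Z i y := volume Phi y * \sum_j invmx (first_form Phi y) i j * partial j f y.
have sZ i y : V y -> strict (Z i) y (fun j => partial j (Z i) y).
  move=> Vy; have [d sd] : exists d, strict (Z i) y d.
    eexists; apply: strictM (volume_strict oV Phi2 fJ Vy) _.
    apply: strict_sum => j; apply: strictM ((Ck2_strict oV Vy f2).2 j).
    exact: (mstrict_inv (first_form_unit fJ Vy) (first_form_strict oV Phi2 Vy) i j).
  have Hd j := (strict_derivable j sd).2.
  by apply: strict_eq _ sd => j; rewrite Hd.
have cV : {for x, continuous (fun y => (volume Phi y)^-1)}.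
  exact: continuousV (lt0r_neq0 (volume_gt0 fJ Vx)) (volume_strict oV Phi2 fJ Vx).1.
apply: (continuousM cV); apply: continuous_at_sum => i.
apply: (@strict_continuous _ _ (Z i) x (fun j => partial j (Z i)) i).
by near=> y; apply: sZ; near: y; exact: open_nbhs_nbhs.
Unshelve. all: by end_near. Qed.

End BoundaryContinuity.

Lemma norm_cos_lt1 (R : realType) (theta : R) : 0 < theta < pi -> `|cos theta| < 1.
Proof.
move=> /sin_gt0_pi s0; rewrite -(@ltr_pXn2r _ 2)// ?nnegrE// real_normK ?num_real// expr1n.
by rewrite -(cos2Dsin2 theta) ltrDl exprn_gt0.
Qed.

Lemma row_continuous (T : topologicalType) (R : realType) m (f : T -> 'rV[R]_m) (x : T) :
  (forall l, {for x, continuous (fun y => f y ord0 l)}) -> {for x, continuous f}.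
Proof.
move=> H A [P HP PA].
have K l : nbhs x [set y | P ord0 l (f y ord0 l)] by exact: H l _ (HP ord0 l).
apply: filterS _ (filter_forall (nbhs_filter x) K) => y Py.
by apply: PA => i l; rewrite ord1; exact: Py.
Qed.

Theorem theorem1p13 (R : realType) (n : nat) (theta : R)
    (hn : (2 <= n)%N) (htheta : 0 < theta < pi) :
  exists2 delta : R, 0 < delta &
    forall (U : set 'rV[R]_n.+1) (M : topologicalType)
           (F nu : M -> 'rV[R]_n.+1),
      relatively_open U ->
      capillary_minimal F nu theta U ->
      let g := fun p : M => capillary_tilt theta (nu p) in
      forall (X : local_param F) (x : 'rV[R]_n) (L : R),
        lp_dom X x -> U (F (lp_map X x)) -> 0 < g (lp_map X x) ->
        is_laplacian X g x L ->
        delta * sqnorm_A_at nu X x <=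
          g (lp_map X x) * (L + sqnorm_A_at nu X x * g (lp_map X x)).
Proof.
pose k : R := if n == 2%N then 1 else (n - 2)%:R^-1.
have n2 : n != 2%N -> (1 <= n - 2)%N by rewrite subn_gt0 ltn_neqAle eq_sym => ->.
have k0 : 0 < k.
  by rewrite /k; case: eqP => // /eqP /n2 n2'; rewrite invr_gt0 ltr0n.
have k1 : k <= 1.
  by rewrite /k; case: eqP => // /eqP /n2 n2'; rewrite invf_le1 ?ltr0n// ler1n.
have hk : n.+1 = 3%N \/ (n.+1%:R - 3) * k = 1.
  rewrite /k; case: eqP => [->|/eqP /n2 n2']; [by left|right].
  have -> : n.+1%:R - 3 = (n - 2)%:R :> R by rewrite natrB// -natr1; ring.
  by rewrite mulfV// pnatr_eq0 -lt0n.
have c1 := norm_cos_lt1 htheta.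
exists (capillary_delta k `|cos theta|); first exact: capillary_delta_gt0.
move=> U M F nu [Q oQ UE] [_ [inH _] _ [cnu nu1 nuT] Hmin _] g X x L Dx Ux gx0
  [W [fe [oW Wx fe2 feE LE]]].
have fex : fe x = g (lp_map X x) by exact: feE.
have [Ox hx] := Dx.
set V1 := lp_open X `&` W.
have oV1 : open V1 by apply: openI => //; exact: lp_open_open.
have V1x : V1 x by [].
have Phi2 l : Ck 2 V1 (fun y => lp_ext X y ord0 l).
  by apply: Ck_sub (lp_C2 X l) => y [].
have f2 : Ck 2 V1 fe by apply: Ck_sub fe2 => y [].
have fJ y : V1 y -> row_free (Defs.jacobian (lp_ext X) y).
  by case=> Oy _; exact: lp_immersion.
have c_ext : {for x, continuous (lp_ext X)}.
  by apply: row_continuous => l; have [cl _] := Phi2 l; exact: cl.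
have c_map z : lp_dom X z -> lp_map X @ within (lp_dom X) (nbhs z) --> lp_map X z.
  by have /subspace_continuousP := @lp_continuous _ _ _ _ X; apply.
have cfe : {for x, continuous fe} by have [cf2 _] := f2; exact: cf2.
pose B := [set y | [/\ V1 y, 0 < fe y & Q (lp_ext X y)]]°.
have Bx : nbhs x B.
  apply: nbhs_interior; near=> y; split.
  - by near: y; exact: open_nbhs_nbhs.
  - by near: y; apply: (@cvgr_gt _ _ _ (nbhs_filter x) _ _ cfe); rewrite fex.
  - near: y; apply: c_ext; apply: open_nbhs_nbhs; split => //.
    by move: Ux; rewrite UE lp_extE// => -[].
pose i0 : 'I_n := Ordinal (ltnW hn).
(* The point [x] may be a boundary point; a positive first coordinate cuts out a set open in R^n on
   which the parametrization is the actual hypersurface. *)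
pose V := B `&` [set y | 0 < y ord0 i0].
have oV : open V.
  apply: openI; first exact: open_interior.
  apply: (@open_comp _ _ (fun y : 'rV[R]_n => y ord0 i0) [set t | 0 < t]).
    by move=> y _; exact: coord_continuous.
  exact: open_gt.
have VV1 y : V y -> [/\ V1 y, 0 < fe y & Q (lp_ext X y)].
  by case=> By _; exact: (interior_subset By).
have Vdom y : V y -> lp_dom X y.
  move=> Vy; have [[Oy _] _ _] := VV1 y Vy; split => // i i0'.
  by have -> : i = i0; [exact: val_inj|case: Vy => _ /ltW].
pose N y := nu (lp_map X y).
have interior y : V y -> capillary_delta k `|cos theta| * sqnorm_A (lp_ext X) (N y) y <=
    fe y * (laplace_beltrami (lp_ext X) fe y + sqnorm_A (lp_ext X) (N y) y * fe y).
  have sV : V `<=` V1 by move=> z /VV1[].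
  move=> Vy; apply: (@interior_bound R n V hn oV (lp_ext X) N _ _ _ _ _ _ k (cos theta)) => //.
  - by move=> l; exact: Ck_sub (Phi2 l).
  - by move=> z /sV; exact: fJ.
  - move=> z l Vz.
    have cz : {for z, continuous (lp_map X)}.
      move=> P HP; have Hz : nbhs z V by exact: open_nbhs_nbhs.
      have HP' : nbhs z [set v | lp_dom X v -> P (lp_map X v)].
        exact: c_map (Vdom z Vz) _ HP.
      by apply: filterS2 _ HP' Hz => v HPv /Vdom; exact: HPv.
    have cnz := continuous_comp cz (cnu (lp_map X z)).
    exact: (continuous_comp cnz (@coord_continuous _ _ _ ord0 l _)).
  - by move=> z _; exact: nu1.
  - by move=> z i /Vdom; exact: nuT.
  - move=> z Vz; have [_ _ Oz] := VV1 z Vz; have Dz := Vdom z Vz.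
    by apply: Hmin => //; rewrite UE; split; [rewrite lp_extE|exact: inH].
  - exact: Ck_sub f2.
  - move=> z Vz; have [[_ Wz] fz _] := VV1 z Vz.
    rewrite feE; last by split => //; exact: Vdom.
    move: fz; rewrite feE; last by split => //; exact: Vdom.
    by rewrite /g /capillary_tilt /g_fun -/k sqrtr_gt0 => fz; rewrite sqr_sqrtr// ltW.
  - by have [] := VV1 y Vy.
(* Moving inward along the first coordinate reaches [x] through [V], whether or not [x] is a
   boundary point. *)
pose y t := shift_dir i0 t x.
have y_x : y t @[t --> at_right (0 : R)] --> x.
  have h0 : t @[t --> at_right (0 : R)] --> (0 : R).
    by apply: cvg_within_filter; exact: cvg_id.
  have h1 := @cvgZr_tmp _ _ _ _ _ _ _ (delta_mx ord0 i0 : 'rV[R]_n) h0.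
  have h2 : (fun=> x) @ at_right (0 : R) --> x by exact: cvg_cst.
  by have := cvgD (h1 _) h2; rewrite scale0r add0r; apply.
have yV : \forall t \near at_right (0 : R), V (y t).
  near=> t; split; first by near: t; exact: (y_x _ Bx).
  have t0 : 0 < t by near: t; exact: (nbhs_right_gt (0 : R)).
  by rewrite /= /y /shift_dir !mxE !eqxx mulr1 ltr_pwDl// hx.
have y_map : lp_map X (y t) @[t --> at_right (0 : R)] --> lp_map X x.
  move=> P HP; have HP' : nbhs x [set v | lp_dom X v -> P (lp_map X v)].
    exact: c_map Dx _ HP.
  suff : \forall t \near at_right (0 : R), P (lp_map X (y t)) by [].
  have Py := y_x _ HP'; near=> t.
  have Pt : lp_dom X (y t) -> P (lp_map X (y t)) by near: t; exact: Py.
  by apply/Pt/Vdom; near: t.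
have yN : mcvg (at_right (0 : R)) (fun t => N (y t)) (N x).
  move=> a l; rewrite (ord1 a).
  apply: (@cvg_comp _ _ _ (fun t => lp_map X (y t)) (fun p => nu p ord0 l) _ _ _ y_map).
  exact: (continuous_comp (cnu (lp_map X x)) (@coord_continuous _ _ _ ord0 l _)).
have cS := sqnorm_A_cvg oV1 Phi2 fJ _ V1x y_x yN.
have cf : fe (y t) @[t --> at_right (0 : R)] --> fe x by exact: cvg_comp y_x cfe.
have cL : laplace_beltrami (lp_ext X) fe (y t) @[t --> at_right (0 : R)] --> L.
  by rewrite LE; exact: cvg_comp y_x (laplace_beltrami_continuous oV1 Phi2 fJ f2 V1x).
have {}cS := cS _.
rewrite -fex -/(sqnorm_A_at nu X x) /sqnorm_A_at -/(N x).
pose S t := sqnorm_A (lp_ext X) (N (y t)) (y t).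
have lhs : capillary_delta k `|cos theta| * S t @[t --> at_right (0 : R)] -->
    capillary_delta k `|cos theta| * sqnorm_A (lp_ext X) (N x) x.
  by apply: cvgM; [exact: cvg_cst|exact: cS].
have rhs : fe (y t) * (laplace_beltrami (lp_ext X) fe (y t) + S t * fe (y t))
    @[t --> at_right (0 : R)] --> fe x * (L + sqnorm_A (lp_ext X) (N x) x * fe x).
  apply: cvgM; first exact: cf.
  apply: cvgD; first exact: cL.
  by apply: cvgM; [exact: cS|exact: cf].
apply: ler_cvg_to lhs rhs _.
by near=> t; apply: interior; near: t.
Unshelve. all: by end_near. Qed.
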